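(* Let $\gamma=\gamma_0+\kappa_+\chi_{D_+}-\kappa_-\chi_{D_-}\in L^\infty_+(\Omega)$ be a conductivity with indefinite inclusion $D=D_+\cup D_-$ with respect to $\gamma_0$, and let $\beta^{\mathrm L}$, $\beta$, $\Lambda_h$, $N^\delta$, $T_\pm$, $T_\pm^h$, $T_\pm^{h,\delta}$, $\mathcal M$, $\mathcal M_\pm$ be as in the context. Let the regularization parameters $\alpha_\pm=\alpha_\pm(h,\delta)[\cdot]\colon\mathcal A\to\mathbb R$ satisfy $$\alpha_\pm^{\mathrm L}(h,\delta)\le\alpha_\pm(h,\delta)[C]\le\alpha_\pm^{\mathrm U}(h,\delta)$$ for all $C\in\mathcal A$ and $h,\delta>0$, where the real-valued functions $\alpha_\pm^{\mathrm L}$ and $\alpha_\pm^{\mathrm U}$ satisfy $$\delta-\alpha_\pm^{\mathrm L}(h,\delta)\le\inf_{C\in\mathcal M}\inf\sigma(T_\pm^h(C))\quad\text{and}\quad\lim_{h,\delta\to0}\alpha_\pm^{\mathrm U}(h,\delta)=0.\qquad( * )$$ Then one has the set-theoretic limit $$\lim_{h,\delta\to0}\mathcal M_{\alpha_+(h,\delta),\alpha_-(h,\delta)}(T_+^{h,\delta},T_-^{h,\delta})=\mathcal M=\bigcap_{h,\delta>0}\mathcal M_{\alpha_+(h,\delta),\alpha_-(h,\delta)}(T_+^{h,\delta},T_-^{h,\delta}).$$ If $\mathcal M$ is replaced by $\mathcal M_\pm$ in $( * )$ (i.e. $\delta-\alpha_\pm^{\mathrm L}(h,\delta)\le\inf_{C\in\mathcal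 M_\pm}\inf\sigma(T_\pm^h(C))$, with matching signs), then one has the set-theoretic limits $$\lim_{h,\delta\to0}\mathcal M_{\alpha_\pm(h,\delta)}(T_\pm^{h,\delta})=\mathcal M_\pm=\bigcap_{h,\delta>0}\mathcal M_{\alpha_\pm(h,\delta)}(T_\pm^{h,\delta}).$$ Every relation containing $\pm$ is understood to hold for both the $+$ version and the $-$ version.
   Context: Setting. $\Omega\subset\mathbb R^d$, $d\ge 2$, is an open bounded domain with $C^\infty$-regular boundary such that $\mathbb R^d\setminus\overline\Omega$ is connected. For real-valued $f$ on $\Omega$, $\inf(f)$ and $\sup(f)$ denote the essential infimum and supremum over $\Omega$. $L^\infty_+(\Omega)=\{w\in L^\infty(\Omega):\inf(w)>0\}$ (real-valued functions). $\chi_C$ is the characteristic function of $C$. Neumann-to-Dirichlet map. $\langle\cdot,\cdot\rangle$ is the $L^2(\partial\Omega)$-inner product, $L^2_\diamond(\partial\Omega)=\{w\in L^2(\partial\Omega):\langle w,1\rangle=0\}$, $H^1_\diamond(\Omega)=\{w\in H^1(\Omega):\langle w|_{\partial\Omega},1\rangle=0\}$, and $\mathcal L(L^2_\diamond(\partial\Omega))$ is the space of bounded linear operators on $L^2_\diamond(\partial\Omega)$. For $\gamma\in L^\infty_+(\Omega)$ and $f\in L^2_\diamond(\partial\Omega)$ let $u\in H^1_\diamond(\Omega)$ be the unique weak solution of $\nabla\cdot(\gamma\nabla u)=0$ in $\Omega$, $\nu\cdot\gamma\nabla u=f$ on $\partial\Omega$ ($\nu$ the outward unit normal). $\Lambda(\gamma)\colon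 L^2_\diamond(\partial\Omega)\to L^2_\diamond(\partial\Omega)$, $f\mapsto u|_{\partial\Omega}$, is a compact self-adjoint operator. For self-adjoint $A\in\mathcal L(L^2_\diamond(\partial\Omega))$, $A\ge 0$ means $\langle Af,f\rangle\ge0$ for all $f\in L^2_\diamond(\partial\Omega)$; $\sigma(A)$ is the spectrum; $\mathrm{Id}$ is the identity. Outer support and test inclusions. For $X\subseteq\overline\Omega$, $X^\bullet=\overline\Omega\setminus\bigcup\{U\subseteq\mathbb R^d\setminus X\text{ open and connected}: U\cap\partial\Omega\ne\emptyset\}$; $D_\pm^\bullet=(D_\pm)^\bullet$. $\mathcal A=\{C\subseteq\overline\Omega\text{ closed}:\mathbb R^d\setminus C\text{ connected}\}$. Indefinite inclusion. $\gamma=\gamma_0+\kappa_+\chi_{D_+}-\kappa_-\chi_{D_-}$ where $\gamma_0,\kappa_+,\kappa_-\in L^\infty_+(\Omega)$, $\sup(\kappa_-)<\inf(\gamma_0)$, and $D_+,D_-\subseteq\Omega$ are open and disjoint (either may be empty). $D=D_+\cup D_-$ is called an indefinite inclusion with respect to $\gamma_0$, provided also: any open neighbourhood of any $x\in\partial D^\bullet$ contains an open ball $B$ such that $B\cap\partial D^\bullet\neq\emptyset$, and either $B\cap D_+^\bullet=\emptyset$ or $B\cap D_-^\bullet=\emptyset$. The constant $\beta^{\mathrm L}>0$ satisfies $\beta^{\mathrm L}\le\gamma_0$ in $\Omega$, and $\beta>0$ satisfies $\sup(\kappa_+)\le\beta$ and $\sup(\kappa_-)\le\tfrac{\beta}{1+\beta}\beta^{\mathrm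 L}$. Approximate models and noise. For each $\delta>0$, $N^\delta\in\mathcal L(L^2_\diamond(\partial\Omega))$ is self-adjoint with $\|N^\delta\|\le\delta$. For each $h>0$ and each $\gamma\in L^\infty_+(\Omega)$, $\Lambda_h(\gamma)\in\mathcal L(L^2_\diamond(\partial\Omega))$ is compact and self-adjoint, and $\|\Lambda(\gamma)-\Lambda_h(\gamma)\|_{\mathcal L(L^2_\diamond(\partial\Omega))}\le\omega(h)\|\gamma\|_{L^\infty(\Omega)}$ for all $\gamma\in L^\infty_+(\Omega)$, with $\lim_{h\to0}\omega(h)=0$. The noisy measurement is $\Lambda_h^\delta(\gamma)=\Lambda_h(\gamma)+N^\delta$. Operators. For measurable $C\subseteq\overline\Omega$: $T_+(C)=\Lambda(\gamma)-\Lambda(\gamma_0+\beta\chi_C)$, $T_-(C)=\Lambda(\gamma_0-\tfrac{\beta}{1+\beta}\beta^{\mathrm L}\chi_C)-\Lambda(\gamma)$; $T_+^h(C)=\Lambda_h(\gamma)-\Lambda_h(\gamma_0+\beta\chi_C)$, $T_-^h(C)=\Lambda_h(\gamma_0-\tfrac{\beta}{1+\beta}\beta^{\mathrm L}\chi_C)-\Lambda_h(\gamma)$; $T_+^{h,\delta}(C)=\Lambda_h^\delta(\gamma)-\Lambda_h(\gamma_0+\beta\chi_C)$, $T_-^{h,\delta}(C)=\Lambda_h(\gamma_0-\tfrac{\beta}{1+\beta}\beta^{\mathrm L}\chi_C)-\Lambda_h^\delta(\gamma)$. Collections. For operator-valued maps $S_\pm$ with $S_\pm(C)\in\mathcal L(L^2_\diamond(\partial\Omega))$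 self-adjoint for each measurable $C\subseteq\overline\Omega$, and for $\alpha_\pm\colon\mathcal A\to\mathbb R$ (constants being allowed), $\mathcal M_{\alpha_+,\alpha_-}(S_+,S_-)=\{C\in\mathcal A: S_+(C)+\alpha_+(C)\mathrm{Id}\ge0\text{ and }S_-(C)+\alpha_-(C)\mathrm{Id}\ge0\}$, and $\mathcal M_\alpha(S)=\mathcal M_{\alpha,\alpha}(S,S)$. Further $\mathcal M_\pm=\mathcal M_0(T_\pm)=\{C\in\mathcal A:T_\pm(C)\ge0\}$ and $\mathcal M=\mathcal M_{0,0}(T_+,T_-)=\mathcal M_+\cap\mathcal M_-$. Set-theoretic limit. For a family of sets $(\mathcal S_{h,\delta})_{h,\delta>0}$, $\lim_{h,\delta\to0}\mathcal S_{h,\delta}=\mathcal S$ means $\bigcup_{\epsilon>0}\bigcap_{h,\delta\in(0,\epsilon]}\mathcal S_{h,\delta}=\mathcal S=\bigcap_{\epsilon>0}\bigcup_{h,\delta\in(0,\epsilon]}\mathcal S_{h,\delta}$. *)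

(* Defs.v *)
From HB Require Import structures.
From mathcomp Require Import all_boot all_order all_algebra.
From mathcomp Require Import all_classical all_reals all_analysis ess_sup_inf.
From mathcomp Require Import complex.

Set Implicit Arguments.
Unset Strict Implicit.
Unset Printing Implicit Defensive.
Import Order.TTheory GRing.Theory Num.Theory.
Import numFieldNormedType.Exports.
Local Open Scope classical_set_scope.
Local Open Scope ring_scope.

(* The Hilbert spaces below are defined over the reals or over the complex
   numbers; conductivities, the test functions defining weak derivatives and
   the regularization parameters are real in both cases. *)
Variant scalars := RealScalars | ComplexScalars.

Definition scalar (R : realType) (k : scalars) : numFieldType :=
  match k with RealScalars => R | ComplexScalars => R[i] end.

Section Scalars.
Context (R : realType).

Definition reK (k : scalars) : scalar R k -> R :=
  match k with RealScalars => fun x => x | ComplexScalars => @complex.Re R end.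

Definition imK (k : scalars) : scalar R k -> R :=
  match k with RealScalars => fun _ => 0 | ComplexScalars => @complex.Im R end.

(* [mkK k a b] is a + ib over the complex numbers, and a over the reals. *)
Definition mkK (k : scalars) : R -> R -> scalar R k :=
  match k with
  | RealScalars => fun a _ => a
  | ComplexScalars => @complex.Complex R
  end.

Definition conjK (k : scalars) (z : scalar R k) : scalar R k :=
  mkK k (reK z) (- imK z).

Definition modulus (k : scalars) (z : scalar R k) : R :=
  Num.sqrt (reK z ^+ 2 + imK z ^+ 2).

End Scalars.

(* Elements of L2 are represented by functions, identified when they agree
   almost everywhere; an operator is a map on representatives, and all the
   properties below only depend on classes modulo a.e. equality. *)

Section L2.
Context (d : measure_display) (T : measurableType d) (R : realType).
Variables (mu : {measure set T -> \bar R}) (k : scalars).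
Local Notation K := (scalar R k).

Definition L2 (f : T -> K) : Prop :=
  (fun x => reK (f x)) \in Lfun mu 2%:E /\ (fun x => imK (f x)) \in Lfun mu 2%:E.

Definition L2norm (f : T -> K) : \bar R :=
  ('N[mu]_2%:E [EFin \o (fun x => modulus (f x))])%E.

Definition L2dist (f g : T -> K) : \bar R := L2norm (fun x => f x - g x).

Definition ip (f g : T -> K) : K :=
  mkK k (\int[mu]_x reK (f x * conjK (g x))) (\int[mu]_x imK (f x * conjK (g x))).

(* <f, 1> = 0. The integrals are taken in \bar R, where a non-integrable
   function cannot have integral 0; [Rintegral] could be 0 by default. *)
Definition mean_zero (f : T -> K) : Prop :=
  (\int[mu]_x (reK (f x))%:E = 0)%E /\ (\int[mu]_x (imK (f x))%:E = 0)%E.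

Definition L2diamond (f : T -> K) : Prop := L2 f /\ mean_zero f.

Definition oper := (T -> K) -> T -> K.

Definition op_add (A B : oper) : oper := fun f x => A f x + B f x.
Definition op_sub (A B : oper) : oper := fun f x => A f x - B f x.
Definition op_scal (z : K) : oper := fun f x => z * f x.

Definition opnorm (A : oper) : \bar R :=
  ereal_inf [set c%:E | c in [set c : R | 0 <= c /\
    forall f, L2diamond f -> (L2norm (A f) <= c%:E * L2norm f)%E]].

Definition bounded_op (A : oper) : Prop :=
  [/\ forall f, L2diamond f -> L2diamond (A f),
      forall (a : K) f g, L2diamond f -> L2diamond g ->
        \forall x \ae mu, A (fun y => a * f y + g y) x = a * A f x + A g x &
      (opnorm A < +oo)%E].

Definition selfadjoint_op (A : oper) : Prop :=
  forall f g, L2diamond f -> L2diamond g -> ip (A f) g = ip f (A g).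

Definition compact_op (A : oper) : Prop :=
  forall f : nat -> T -> K,
    (forall n, L2diamond (f n)) -> (exists c : R, forall n, (L2norm (f n) <= c%:E)%E) ->
    exists (s : nat -> nat) (g : T -> K),
      [/\ {homo s : m n / (m < n)%N}, L2diamond g &
          (fun n => L2dist (A (f (s n))) g) @ \oo --> 0%E].

Definition pos_op (A : oper) : Prop :=
  forall f, L2diamond f -> 0 <= ip (A f) f.

(* Complement of the set of z for which A - z Id has a bounded inverse B. *)
Definition spectrum (A : oper) : set K := [set z | ~ exists B : oper,
  bounded_op B /\ forall f, L2diamond f ->
    (\forall x \ae mu, B (op_sub A (op_scal z) f) x = f x) /\
    (\forall x \ae mu, op_sub A (op_scal z) (B f) x = f x)].

(* The infimum of the real spectrum; only used for self-adjoint operators,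
   the spectrum of which is real. *)
Definition inf_spectrum (A : oper) : \bar R :=
  ereal_inf [set r%:E | r in [set r : R | spectrum A (mkK k r 0)]].

End L2.

Section OuterMeasures.
Context (R : realType) (T : pointedType).

Definition cover_outer (w : set T -> \bar R) (A : set T) : \bar R :=
  ereal_inf [set (\sum_(i <oo) w (F i))%E |
             F in [set F : (set T)^nat | A `<=` \bigcup_i F i]].

Lemma cover_outerE (w : set T -> \bar R) :
  cover_outer w = @mu_ext _ (g_sigma_algebraType [set: set T]) R w.
Proof.
apply/funext => A; rewrite /cover_outer /mu_ext; congr ereal_inf.
apply/seteqP; split => _ [F FA <-]; exists F => //=.
  by split => // i; exact: sub_sigma_algebra.
by case: FA.
Qed.

Lemma cover_outer_subproof (w : set T -> \bar R) :
  w set0 = 0%E -> (forall A, 0 <= w A)%E -> isOuterMeasure R T (cover_outer w).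
Proof.
move=> w0 w_ge0; rewrite cover_outerE; split.
- exact: (@mu_ext0 _ (g_sigma_algebraType [set: set T])).
- exact: (@mu_ext_ge0 _ (g_sigma_algebraType [set: set T])).
- exact: (@le_mu_ext _ (g_sigma_algebraType [set: set T])).
- exact: (@mu_ext_sigma_subadditive _ (g_sigma_algebraType [set: set T])).
Qed.

Definition restr_outer (mu : {outer_measure set T -> \bar R}) (D A : set T) :=
  mu (A `&` D).

Lemma restr_outer_subproof (mu : {outer_measure set T -> \bar R}) D :
  isOuterMeasure R T (restr_outer mu D).
Proof.
split; rewrite /restr_outer.
- by rewrite set0I outer_measure0.
- by move=> A; exact: outer_measure_ge0.
- by move=> A B AB; apply: le_outer_measure; exact: setSI.
- by move=> F; rewrite setI_bigcupl; exact: outer_measure_sigma_subadditive.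
Qed.

HB.instance Definition _ mu D := restr_outer_subproof mu D.

End OuterMeasures.

Section EuclideanSpace.
Context (R : realType) (d : nat).
Local Notation E := 'rV[R]_d.

Definition enorm (x : E) : R := Num.sqrt (\sum_(i < d) x 0 i ^+ 2).

Definition open_ball (B : set E) : Prop :=
  exists (c : E) (r : R), 0 < r /\ B = [set x | enorm (x - c) < r].

(* Volume of the closed box with opposite corners a and b; any set that is
   neither empty nor a closed box has gauge +oo, i.e. cannot be used in a cover. *)
Definition box_gauge (A : set E) : \bar R :=
  if `[< A = set0 >] then 0%E
  else ereal_inf [set (\prod_(i < d) (p.2 0 i - p.1 0 i))%:E |
    p in [set p : E * E | (forall i, p.1 0 i <= p.2 0 i) /\
                          A = [set x | forall i, p.1 0 i <= x 0 i <= p.2 0 i]]].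

Lemma box_gauge0 : box_gauge set0 = 0%E.
Proof. by rewrite /box_gauge; case: asboolP. Qed.

Lemma box_gauge_ge0 A : (0 <= box_gauge A)%E.
Proof.
rewrite /box_gauge; case: asboolP => // _.
apply/le_ereal_inf_tmp => _ [p [p12 _] <-].
by rewrite lee_fin; apply: prodr_ge0 => i _; rewrite subr_ge0.
Qed.

Definition lebesgue_outer := cover_outer box_gauge.

HB.instance Definition _ : isOuterMeasure R E lebesgue_outer :=
  cover_outer_subproof box_gauge0 box_gauge_ge0.

(* Volume of the unit ball of R^m, by V_(m+2) = 2 pi / (m + 2) V_m. *)
Fixpoint unit_ball_volume (m : nat) : R :=
  match m with
  | 0%N => 1
  | 1%N => 2
  | (m'.+2)%N => 2 * pi / m'.+2%:R * unit_ball_volume m'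
  end.

Lemma unit_ball_volume_ge0 m : 0 <= unit_ball_volume m.
Proof.
suff: 0 <= unit_ball_volume m /\ 0 <= unit_ball_volume m.+1 by case.
elim: m => [|m [IH1 IH2]]; first by rewrite ler01 ler0n.
split=> //=; apply: mulr_ge0 => //.
by rewrite divr_ge0// mulr_ge0// pi_ge0.
Qed.

(* The point 0 is added so that the empty set has diameter 0 and not -oo. *)
Definition diam (A : set E) : \bar R :=
  ereal_sup (0%E |` [set (enorm (p.1 - p.2))%:E | p in A `*` A]).

Lemma diam_ge0 A : (0 <= diam A)%E.
Proof. by apply: ereal_sup_ubound; left. Qed.

Definition hausdorff_gauge (m : nat) (delta : R) (A : set E) : \bar R :=
  if `[< A = set0 >] then 0%E
  else if (diam A <= delta%:E)%E then
    ((unit_ball_volume m)%:E * (diam A * (2^-1)%:E) ^+ m)%E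
  else +oo%E.

Lemma hausdorff_gauge0 m delta : hausdorff_gauge m delta set0 = 0%E.
Proof. by rewrite /hausdorff_gauge; case: asboolP. Qed.

Lemma hausdorff_gauge_ge0 m delta A : (0 <= hausdorff_gauge m delta A)%E.
Proof.
rewrite /hausdorff_gauge; case: asboolP => // _; case: ifP => // _.
apply: mule_ge0; first by rewrite lee_fin unit_ball_volume_ge0.
by apply: expe_ge0; apply: mule_ge0; rewrite ?diam_ge0 ?lee_fin.
Qed.

HB.instance Definition _ m delta :
    isOuterMeasure R E (cover_outer (hausdorff_gauge m delta)) :=
  cover_outer_subproof (hausdorff_gauge0 m delta) (hausdorff_gauge_ge0 m delta).

(* m-dimensional Hausdorff outer measure, normalized so that it coincides with
   the surface measure on m-dimensional submanifolds. *)
Definition hausdorff_outer (m : nat) (A : set E) : \bar R :=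
  ereal_sup [set cover_outer (hausdorff_gauge m delta) A |
             delta in [set delta : R | 0 < delta]].

Lemma hausdorff_outer_subproof m : isOuterMeasure R E (hausdorff_outer m).
Proof.
have ge0 A : (0 <= hausdorff_outer m A)%E.
  apply: (@le_trans _ _ (cover_outer (hausdorff_gauge m 1) A)).
    exact: outer_measure_ge0.
  by apply: ereal_sup_ubound; exists 1 => //=.
split=> //.
- apply/eqP; rewrite eq_le ge0 andbT; apply: ge_ereal_sup => _ [e e0 <-].
  by rewrite outer_measure0.
- move=> A B AB; apply: ge_ereal_sup => _ [e e0 <-].
  apply: (@le_trans _ _ (cover_outer (hausdorff_gauge m e) B)).
    exact: le_outer_measure.
  by apply: ereal_sup_ubound; exists e.
- move=> F; apply: ge_ereal_sup => _ [e e0 <-].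
  apply: (le_trans (outer_measure_sigma_subadditive _ _)).
  apply: lee_nneseries => [i _ _|i _]; first exact: outer_measure_ge0.
  by apply: ereal_sup_ubound; exists e.
Qed.

HB.instance Definition _ m := hausdorff_outer_subproof m.

Definition boundary (A : set E) : set E := closure A `\` interior A.

Definition volume_outer (Omega : set E) : {outer_measure set E -> \bar R} :=
  restr_outer lebesgue_outer Omega.

Definition surface_outer (Omega : set E) : {outer_measure set E -> \bar R} :=
  restr_outer (hausdorff_outer d.-1) (boundary Omega).

(* Lebesgue measure on Omega and surface measure on its boundary, as
   (complete) measures on the ambient space that only charge Omega,
   respectively its boundary. *)
Definition volume (Omega : set E) :
    {measure set (caratheodory_type (volume_outer Omega)) -> \bar R} :=
  volume_outer Omega.

Definition surface (Omega : set E) :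
    {measure set (caratheodory_type (surface_outer Omega)) -> \bar R} :=
  surface_outer Omega.

Definition partial (i : 'I_d) (f : E -> R) (x : E) : R := 'D_(delta_mx 0 i) f x.

Fixpoint Cn (n : nat) (f : E -> R) : Prop :=
  continuous f /\
  match n with
  | 0%N => True
  | n'.+1 => forall i : 'I_d,
      (forall x, derivable f x (delta_mx 0 i)) /\ Cn n' (partial i f)
  end.

Definition smooth (f : E -> R) : Prop := forall n, Cn n f.

Definition test_function (Omega : set E) (phi : E -> R) : Prop :=
  [/\ smooth phi, compact (closure [set x | phi x != 0]) &
      closure [set x | phi x != 0] `<=` Omega].

(* Near each boundary point, Omega is the sublevel set of a smooth function
   with nonvanishing gradient. *)
Definition smooth_boundary (Omega : set E) : Prop :=
  forall x, boundary Omega x -> exists (U : set E) (phi : E -> R),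
    [/\ open U, U x, smooth phi,
        forall y, U y -> exists i, partial i phi y != 0 &
        forall y, U y -> (Omega y <-> phi y < 0)].

Definition smooth_domain (Omega : set E) : Prop :=
  [/\ open Omega, connected Omega, Omega !=set0, bounded_set Omega &
      smooth_boundary Omega].

Definition Linf_plus (Omega : set E) (w : E -> R) : Prop :=
  w \in Lfun (volume Omega) +oo%E /\
  (0 < ess_inf (volume Omega) (fun x => (w x)%:E))%E.

Section NtD.
Variables (k : scalars) (Omega : set E).
Local Notation K := (scalar R k).

Definition partialK (i : 'I_d) (f : E -> K) (x : E) : K :=
  mkK k (partial i (fun y => reK (f y)) x) (partial i (fun y => imK (f y)) x).

Definition weak_gradient (u : E -> K) (g : 'I_d -> E -> K) : Prop :=
  forall (i : 'I_d) (phi : E -> R), test_function Omega phi ->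
    (\int[volume Omega]_x (reK (u x) * partial i phi x) =
      - (\int[volume Omega]_x (reK (g i x) * phi x))) /\
    (\int[volume Omega]_x (imK (u x) * partial i phi x) =
      - (\int[volume Omega]_x (imK (g i x) * phi x))).

Definition H1 (u : E -> K) (g : 'I_d -> E -> K) : Prop :=
  [/\ L2 (volume Omega) u, forall i, L2 (volume Omega) (g i) &
      weak_gradient u g].

(* t is the trace on the boundary of the function u in H^1(Omega) with
   gradient g: the trace map is the continuous extension to H^1(Omega) of the
   restriction to the boundary of functions that are smooth up to it. *)
Definition H1_trace (u : E -> K) (g : 'I_d -> E -> K) (t : E -> K) : Prop :=
  [/\ H1 u g, L2 (surface Omega) t &
      exists phi : nat -> E -> K,
        [/\ forall n, smooth (fun x => reK (phi n x)) /\
                      smooth (fun x => imK (phi n x)),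
            (fun n => L2dist (volume Omega) (phi n) u) @ \oo --> 0%E,
            forall i, (fun n => L2dist (volume Omega) (partialK i (phi n)) (g i))
                        @ \oo --> 0%E &
            (fun n => L2dist (surface Omega) (phi n) t) @ \oo --> 0%E]].

(* t is the trace of a weak solution u in H^1_diamond(Omega) of the Neumann
   problem with conductivity gamma and current f. *)
Definition is_NtD (gamma : E -> R) (f t : E -> K) : Prop :=
  exists (u : E -> K) (g : 'I_d -> E -> K),
    [/\ H1_trace u g t, mean_zero (surface Omega) t &
        forall (v : E -> K) (gv : 'I_d -> E -> K) (tv : E -> K),
          H1_trace v gv tv ->
          \sum_(i < d) ip (volume Omega) (fun x => mkK k (gamma x) 0 * g i x) (gv i)
            = ip (surface Omega) f tv].

(* Lambda(gamma) f. By well-posedness of the Neumann problem, for gamma in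
   L^oo_+ and f in L2_diamond the trace exists and is unique up to a.e.
   equality; the default value 0 is irrelevant. *)
Definition NtD (gamma : E -> R) : oper (caratheodory_type (surface_outer Omega)) R k :=
  fun f => xget (fun=> 0) [set t | is_NtD gamma f t].

End NtD.

Definition outer_support (Omega X : set E) : set E :=
  closure Omega `\` \bigcup_(U in [set U : set E |
    [/\ U `<=` ~` X, open U, connected U & U `&` boundary Omega !=set0]]) U.

Definition test_inclusion (Omega C : set E) : Prop :=
  [/\ C `<=` closure Omega, closed C & connected (~` C)].

Definition indefinite_gamma (gamma0 kappap kappam : E -> R) (Dp Dm : set E) (x : E) : R :=
  gamma0 x + kappap x * \1_Dp x - kappam x * \1_Dm x.

Definition indefinite_inclusion (Omega : set E) (gamma0 kappap kappam : E -> R)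
    (Dp Dm : set E) : Prop :=
  [/\ [/\ Linf_plus Omega gamma0, Linf_plus Omega kappap & Linf_plus Omega kappam],
      (ess_sup (volume Omega) (fun x => (kappam x)%:E) <
       ess_inf (volume Omega) (fun x => (gamma0 x)%:E))%E,
      [/\ open Dp, open Dm, Dp `<=` Omega, Dm `<=` Omega & Dp `&` Dm = set0] &
      let Dbd := boundary (outer_support Omega (Dp `|` Dm)) in
      forall (x : E) (V : set E), Dbd x -> open V -> V x ->
        exists B : set E, [/\ open_ball B, B `<=` V, B `&` Dbd !=set0 &
          B `&` outer_support Omega Dp = set0 \/
          B `&` outer_support Omega Dm = set0]].

Variant sgn := Plus | Minus.

Section Collections.
Variables (k : scalars) (Omega : set E).
Local Notation op := (oper (caratheodory_type (surface_outer Omega)) R k).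

(* [Lmeas] is the measured operator, and [L] the forward model: this gives
   T_s, T_s^h and T_s^{h,delta} for Lambda(gamma) and Lambda,
   Lambda_h(gamma) and Lambda_h, Lambda_h^delta(gamma) and Lambda_h. *)
Definition Top (gamma0 : E -> R) (beta betaL : R) (Lmeas : op) (L : (E -> R) -> op)
    (s : sgn) (C : set E) : op :=
  match s with
  | Plus => op_sub Lmeas (L (fun x => gamma0 x + beta * \1_C x))
  | Minus =>
      op_sub (L (fun x => gamma0 x - beta / (1 + beta) * betaL * \1_C x)) Lmeas
  end.

Definition Mset2 (alphap alpham : set E -> R) (Sp Sm : set E -> op) : set (set E) :=
  [set C | [/\ test_inclusion Omega C,
     pos_op (surface Omega) (op_add (Sp C) (op_scal (mkK k (alphap C) 0))) &
     pos_op (surface Omega) (op_add (Sm C) (op_scal (mkK k (alpham C) 0)))]].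

Definition Mset1 (alpha : set E -> R) (S : set E -> op) : set (set E) :=
  Mset2 alpha alpha S S.

Definition approximate_model (Lambdah : R -> (E -> R) -> op) (omega : R -> R) : Prop :=
  (forall h w, 0 < h -> Linf_plus Omega w ->
    [/\ bounded_op (surface Omega) (Lambdah h w),
        compact_op (surface Omega) (Lambdah h w),
        selfadjoint_op (surface Omega) (Lambdah h w) &
        (opnorm (surface Omega) (op_sub (NtD w) (Lambdah h w)) <=
         (omega h)%:E * 'N[volume Omega]_+oo [EFin \o w])%E]) /\
  omega @ 0^'+ --> (0 : R).

Definition noise_model (N : R -> op) : Prop :=
  forall delta, 0 < delta ->
    [/\ bounded_op (surface Omega) (N delta),
        selfadjoint_op (surface Omega) (N delta) &
        (opnorm (surface Omega) (N delta) <= delta%:E)%E].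

End Collections.

End EuclideanSpace.

Definition set_limit (R : realType) (X : Type) (S : R -> R -> set X) (L : set X) : Prop :=
  let I (e : R) := [set p : R * R | 0 < p.1 <= e /\ 0 < p.2 <= e] in
  \bigcup_(e in [set e : R | 0 < e]) \bigcap_(p in I e) S p.1 p.2 = L /\
  L = \bigcap_(e in [set e : R | 0 < e]) \bigcup_(p in I e) S p.1 p.2.

(* Main.v *)
Require Import Defs.
From HB Require Import structures.
From mathcomp Require Import all_boot all_order all_algebra.
From mathcomp Require Import all_classical all_reals all_analysis ess_sup_inf measurable_realfun.
From mathcomp Require Import complex ring lra.

Set Implicit Arguments.
Unset Strict Implicit.
Unset Printing Implicit Defensive.
Import Order.TTheory GRing.Theory Num.Theory.
Import numFieldNormedType.Exports.
Local Open Scope classical_set_scope.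
Local Open Scope ring_scope.

(** For a fixed test inclusion [C], the noisy operator of sign [s] differs
    from [T s C] by at most a constant times [omega h], plus [delta], in
    operator norm. Writing [S h delta] for the noisy collection and [L] for
    the exact one, both the set limit and the intersection formula follow
    from two facts ([set_limit_squeeze]).

    First, [L] is contained in every [S h delta] ([noisy_test_passes]). A
    bounded self-adjoint operator dominates the infimum of its spectrum
    ([inf_spectrum_form]), so the condition on the lower bound of the
    regularization parameter says that the noiseless discretized operator
    plus [alpha] is at least [delta], and the noise takes away at most
    [delta].

    Second, an inclusion that passes the noisy test for arbitrarily small
    [h] and [delta] passes the exact one ([exact_test_passes]): at every
    fixed boundary current the form of [T s C] is a limit of noisy forms, up
    to a term bounded by the upper bound of [alpha], which tends to zero. Over
    the complex numbers positivity of a form includes that it is real, and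
    this passes to the limit in the same way. The operator [NtD w] is only
    handled through its distance to the self-adjoint models.

    The spectral bound is obtained without spectral theory. Let [a] be the
    infimum of the Rayleigh quotient of [A]. If [A - a] had a bounded inverse,
    the form of [A - a], being nonnegative, would be bounded below by a
    positive multiple of the squared norm ([coercive_of_resolvent]), against
    the choice of [a]; so [a] lies in the spectrum.

    Both facts apply the models to the conductivities [gamma0] plus or minus a
    multiple of the characteristic function of [C]; these lie in [Linf_plus]
    because closed sets are measurable for the volume
    ([closed_volume_measurable]), which for an outer measure defined by
    covers with closed boxes comes down to cutting boxes along coordinate
    hyperplanes.

    All the Hilbert space arguments use the real inner product [rip], the real
    part of [ip]. The imaginary part of [ip f g] is the real inner product of
    [f] with [rotate g], that is, with [g] multiplied by the imaginary unit. *)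

(** * Real and imaginary parts of scalars *)

Section ScalarFacts.
Context (R : realType) (k : scalars).
Implicit Types (z w : Defs.scalar R k) (a : R).

Lemma reKD z w : reK (z + w) = reK z + reK w.
Proof. by case: k z w => [|] // [? ?] [? ?]. Qed.

Lemma imKD z w : imK (z + w) = imK z + imK w.
Proof. by case: k z w => [|] => [? ?|[? ?] [? ?]] //=; rewrite addr0. Qed.

Lemma reKN z : reK (- z) = - reK z.
Proof. by case: k z => [|] // [? ?]. Qed.

Lemma imKN z : imK (- z) = - imK z.
Proof. by case: k z => [|] => [?|[? ?]] //=; rewrite oppr0. Qed.

Lemma reKZ a z : reK (mkK k a 0 * z) = a * reK z.
Proof. by case: k z => [|] // [? ?] /=; rewrite mul0r subr0. Qed.

Lemma imKZ a z : imK (mkK k a 0 * z) = a * imK z.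
Proof. by case: k z => [?|[x y]] /=; rewrite ?mulr0 ?mul0r ?addr0. Qed.

Lemma reK0 : reK (0 : Defs.scalar R k) = 0.
Proof. by case: k. Qed.

Lemma imK0 : imK (0 : Defs.scalar R k) = 0.
Proof. by case: k. Qed.

Lemma scalar_ext z w : reK z = reK w -> imK z = imK w -> z = w.
Proof. by case: k z w => [|] // [? ?] [? ?] /= -> ->. Qed.

Lemma reK_mul_conj z w : reK (z * conjK w) = reK z * reK w + imK z * imK w.
Proof. by case: k z w => [z w|[a b] [c e]] /=; ring. Qed.

Lemma imK_mul_conj z w :
  imK (z * conjK w) = reK z * reK (mkK k (- imK w) (reK w))
                      + imK z * imK (mkK k (- imK w) (reK w)).
Proof. by case: k z w => [z w|[a b] [c e]] /=; ring. Qed.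

Lemma mkK_ge0 a b : 0 <= mkK k a b -> 0 <= a.
Proof. by case: k => //=; rewrite lecE /= => /andP[]. Qed.

End ScalarFacts.

(** * The real inner product on square-integrable functions *)

Lemma LfunD d (T : measurableType d) (R : realType) (mu : {measure set T -> \bar R})
    (p : \bar R) (f g : T -> R) :
  (1 <= p)%E -> f \in Lfun mu p -> g \in Lfun mu p ->
  (fun x => f x + g x) \in Lfun mu p.
Proof. by move=> p1; have [_] := Lfun_addr_closed mu p1; exact. Qed.

Section RealInnerProduct.
Context (d : measure_display) (T : measurableType d) (R : realType).
Variables (mu : {measure set T -> \bar R}) (k : scalars).
Local Notation K := (Defs.scalar R k).
Implicit Types (f g u : T -> K) (a c : R).

Definition rip f g : R :=
  \int[mu]_x (reK (f x) * reK (g x) + imK (f x) * imK (g x)).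

Definition scalef a f : T -> K := fun x => mkK k a 0 * f x.

(** Multiplication by the imaginary unit over the complex numbers; over the
    real numbers it is the zero function, which makes the formula [imK_ip] for
    the imaginary part valid in both cases. *)
Definition rotate f : T -> K := fun x => mkK k (- imK (f x)) (reK (f x)).

Lemma L2D f g : L2 mu f -> L2 mu g -> L2 mu (fun x => f x + g x).
Proof.
move=> [f1 f2] [g1 g2]; split.
- have -> : (fun x => reK (f x + g x)) = (fun x => reK (f x) + reK (g x)).
    by apply/funext => x; exact: reKD.
  by apply: LfunD; rewrite ?lee_fin ?ler1n.
- have -> : (fun x => imK (f x + g x)) = (fun x => imK (f x) + imK (g x)).
    by apply/funext => x; exact: imKD.
  by apply: LfunD; rewrite ?lee_fin ?ler1n.
Qed.

Lemma L2Z a f : L2 mu f -> L2 mu (scalef a f).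
Proof.
move=> [f1 f2]; split.
- have -> : (fun x => reK (scalef a f x)) = (fun x => reK (f x) * a).
    by apply/funext => x; rewrite /scalef reKZ mulrC.
  by apply: Lfun_scale f1; rewrite ler1n.
- have -> : (fun x => imK (scalef a f x)) = (fun x => imK (f x) * a).
    by apply/funext => x; rewrite /scalef imKZ mulrC.
  by apply: Lfun_scale f2; rewrite ler1n.
Qed.

Lemma scalefN1 f : (fun x => - f x) = scalef (-1) f.
Proof.
apply/funext => x; apply: scalar_ext.
- by rewrite reKN /scalef reKZ mulN1r.
- by rewrite imKN /scalef imKZ mulN1r.
Qed.

Lemma L2N f : L2 mu f -> L2 mu (fun x => - f x).
Proof. by rewrite scalefN1; exact: L2Z. Qed.

Lemma L2B f g : L2 mu f -> L2 mu g -> L2 mu (fun x => f x - g x).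
Proof. by move=> Lf Lg; apply: L2D => //; exact: L2N. Qed.

Lemma L2_cst0 : L2 mu (fun=> 0 : K).
Proof.
split.
- have -> : (fun=> reK (0 : K)) = (fun=> 0 : R) :> (T -> R).
    by apply/funext => x; exact: reK0.
  by case: (Lfun_addr_closed mu (lee1n 2)).
- have -> : (fun=> imK (0 : K)) = (fun=> 0 : R) :> (T -> R).
    by apply/funext => x; exact: imK0.
  by case: (Lfun_addr_closed mu (lee1n 2)).
Qed.

Lemma L2_rotate f : L2 mu f -> L2 mu (rotate f).
Proof.
rewrite /L2 /rotate; case: (k) f => f [f1 f2] /=.
- by split; [exact: Lfun_oppr_closed f2 | exact: f2].
- by split; [exact: Lfun_oppr_closed f2 | exact: f1].
Qed.

Lemma rip_integrable f g : L2 mu f -> L2 mu g ->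
  mu.-integrable setT
    (EFin \o (fun x => reK (f x) * reK (g x) + imK (f x) * imK (g x))).
Proof.
move=> [f1 f2] [g1 g2].
have H1 := Lfun2_mul_Lfun1 f1 g1.
have H2 := Lfun2_mul_Lfun1 f2 g2.
apply/Lfun1_integrable.
exact: LfunD.
Qed.

Lemma ripC f g : rip f g = rip g f.
Proof. by apply: eq_Rintegral => x _; ring. Qed.

Lemma ripDl f g u : L2 mu f -> L2 mu g -> L2 mu u ->
  rip (fun x => f x + g x) u = rip f u + rip g u.
Proof.
move=> Lf Lg Lu; rewrite /rip -RintegralD//; try exact: rip_integrable.
by apply: eq_Rintegral => x _; rewrite reKD imKD; ring.
Qed.

Lemma ripZl a f u : L2 mu f -> L2 mu u -> rip (scalef a f) u = a * rip f u.
Proof.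
move=> Lf Lu; rewrite /rip -RintegralZl//; last exact: rip_integrable.
by apply: eq_Rintegral => x _; rewrite /scalef reKZ imKZ; ring.
Qed.

Lemma ripNl f u : L2 mu f -> L2 mu u -> rip (fun x => - f x) u = - rip f u.
Proof. by move=> Lf Lu; rewrite scalefN1 ripZl// mulN1r. Qed.

Lemma ripBl f g u : L2 mu f -> L2 mu g -> L2 mu u ->
  rip (fun x => f x - g x) u = rip f u - rip g u.
Proof. by move=> Lf Lg Lu; rewrite ripDl ?ripNl//; exact: L2N. Qed.

Lemma ripDr f g u : L2 mu f -> L2 mu g -> L2 mu u ->
  rip u (fun x => f x + g x) = rip u f + rip u g.
Proof. by move=> Lf Lg Lu; rewrite ripC ripDl// !(ripC u). Qed.

Lemma ripZr a f u : L2 mu f -> L2 mu u -> rip u (scalef a f) = a * rip u f.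
Proof. by move=> Lf Lu; rewrite ripC ripZl// ripC. Qed.

Lemma rip_ge0 f : 0 <= rip f f.
Proof.
apply: Rintegral_ge0 => x _.
by rewrite addr_ge0 // -expr2 sqr_ge0.
Qed.

Lemma L2_measurable f : L2 mu f ->
  measurable_fun setT (fun x => reK (f x)) /\ measurable_fun setT (fun x => imK (f x)).
Proof.
move=> [/sub_Lfun_mfun Rf /sub_Lfun_mfun If].
by rewrite !inE in Rf If.
Qed.

Lemma eq_rip_ae f g u : L2 mu f -> L2 mu g -> L2 mu u ->
  (\forall x \ae mu, f x = g x) -> rip f u = rip g u.
Proof.
move=> Lf Lg Lu fg; rewrite /rip /Rintegral; congr fine.
apply: ae_eq_integral => //.
- exact: measurable_int (rip_integrable Lf Lu).
- exact: measurable_int (rip_integrable Lg Lu).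
- by apply: filterS fg => x -> _.
Qed.

Lemma L2norm_sqr f : L2 mu f -> (L2norm mu f `^ 2 = (rip f f)%:E)%E.
Proof.
move=> Lf; rewrite /L2norm powR_Lnorm// /rip /Rintegral fineK; last first.
  exact: integrable_fin_num (rip_integrable Lf Lf).
apply: eq_integral => x _; rewrite /= /modulus ger0_norm ?sqrtr_ge0//; congr EFin.
by rewrite powR_mulrn ?sqrtr_ge0// sqr_sqrtr ?addr_ge0 ?sqr_ge0// !expr2.
Qed.

Lemma rip_le_of_norm c f g : 0 <= c -> L2 mu f -> L2 mu g ->
  (L2norm mu g <= c%:E * L2norm mu f)%E -> rip g g <= c ^+ 2 * rip f f.
Proof.
move=> c0 Lf Lg gf; rewrite -lee_fin EFinM -!L2norm_sqr//.
have -> : (c ^+ 2)%:E = (c%:E `^ 2)%E by rewrite poweR_EFin powR_mulrn.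
rewrite -poweRM ?lee_fin ?Lnorm_ge0//.
by rewrite gt0_ler_poweR// in_itv/= leey ?mule_ge0 ?lee_fin ?Lnorm_ge0.
Qed.

Lemma rip_rotate f : L2 mu f -> rip (rotate f) (rotate f) <= rip f f.
Proof.
move=> Lf; apply: le_Rintegral => //; try (apply: rip_integrable => //);
  try exact: L2_rotate.
rewrite /rotate => x _; case: (k) f Lf => f Lf /=; last by rewrite mulrNN addrC.
by rewrite oppr0 !mul0r !addr0 -expr2 sqr_ge0.
Qed.

Lemma ipE f g : ip mu f g = mkK k (rip f g) (rip f (rotate g)).
Proof.
rewrite /ip; congr mkK; apply: eq_Rintegral => x _.
- exact: reK_mul_conj.
- exact: imK_mul_conj.
Qed.

(** Cauchy-Schwarz: comparing both squared norms with the same number [b]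
    keeps square roots out of the estimate. *)
Lemma cauchy_schwarz_rip c b f g : L2 mu f -> L2 mu g -> 0 <= c ->
  rip f f <= c ^+ 2 * b -> rip g g <= b -> `|rip f g| <= c * b.
Proof.
move=> Lf Lg c0 fb gb.
have b0 : 0 <= b by apply: le_trans gb; exact: rip_ge0.
have key e : 0 <= rip f f + 2 * e * rip f g + e ^+ 2 * rip g g.
  have := rip_ge0 (fun x => f x + scalef e g x).
  have Le := L2Z e Lg; have Lfe := L2D Lf Le.
  by rewrite ripDl// !ripDr// !ripZl// !ripZr// (ripC g f); lra.
have := key c; have := key (- c).
have c2 : c ^+ 2 * rip g g <= c ^+ 2 * b by rewrite ler_wpM2l ?sqr_ge0.
move: c0; rewrite le_eqVlt => /predU1P[c0|c0 k1 k2].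
  (* f is null: use f + e g with e of the sign opposite to rip f g *)
  subst c; move=> _ _; move: fb c2; rewrite expr0n /= !mul0r => ff _.
  have {}ff : rip f f = 0 by apply/le_anti; rewrite ff rip_ge0.
  pose t := rip f g / (rip g g + 1).
  have g1 : rip g g + 1 != 0 by rewrite gt_eqF// ltr_wpDl// rip_ge0.
  have rE : rip f g = t * (rip g g + 1) by rewrite /t divfK.
  have tg : 0 <= t ^+ 2 * rip g g by rewrite mulr_ge0 ?sqr_ge0 ?rip_ge0.
  have t0 : t ^+ 2 <= 0 by have := key (- t); rewrite ff sqrrN rE; lra.
  have {}t0 : t == 0 by rewrite -sqrf_eq0; apply/eqP/le_anti; rewrite t0 sqr_ge0.
  by rewrite rE (eqP t0) mul0r normr0.
have cb : c * (c * b) = c ^+ 2 * b by ring.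
by rewrite ler_norml; apply/andP; split; rewrite -(ler_pM2l c0); lra.
Qed.

End RealInnerProduct.

(** * Positivity of a form in terms of the real inner product *)

Section Positivity.
Context (d : measure_display) (T : measurableType d) (R : realType).
Variables (mu : {measure set T -> \bar R}) (k : scalars).
Local Notation K := (Defs.scalar R k).
Implicit Types (f g : T -> K).

Lemma rip_rotateC f g : L2 mu f -> L2 mu g ->
  rip mu f (rotate g) = - rip mu g (rotate f).
Proof.
move=> Lf Lg; rewrite -mulN1r -RintegralZl//; last first.
  by apply: rip_integrable => //; exact: L2_rotate.
by apply: eq_Rintegral => x _; rewrite /rotate; case: (k) f g {Lf Lg} => f g /=; ring.
Qed.

Lemma reK_ip f g : reK (ip mu f g) = rip mu f g.
Proof. by rewrite ipE; move: (rip _ _ _) (rip _ _ _); case: (k). Qed.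

Lemma imK_ip f g : imK (ip mu f g) = rip mu f (rotate g).
Proof.
rewrite ipE /rip /rotate; case: (k) f g => f g //=.
rewrite (@eq_Rintegral _ _ _ mu setT (fun=> 0)) => [|x _]; last by rewrite oppr0 mulr0 mul0r addr0.
by rewrite Rintegral_cst// mul0r.
Qed.

Lemma ip_ge0P f g :
  0 <= ip mu f g <-> 0 <= rip mu f g /\ rip mu f (rotate g) = 0.
Proof.
split=> [fg|[fg0 fgi]].
- split; first by move: fg; rewrite ipE; exact: mkK_ge0.
  by rewrite -imK_ip; move: (ip mu f g) fg; case: (k) => //= z; rewrite lecE => /andP[/eqP].
- rewrite ipE fgi; move: (rip mu f g) fg0; case: (k) => //= r r0; by rewrite lecE /= eqxx.
Qed.

End Positivity.

(** * Bounded self-adjoint operators dominate the infimum of their spectrum *)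

Section Operators.
Context (d : measure_display) (T : measurableType d) (R : realType).
Variables (mu : {measure set T -> \bar R}) (k : scalars).
Local Notation K := (Defs.scalar R k).
Implicit Types (A B : oper T R k) (f g : T -> K) (a c : R).

(** In the extended reals the difference of two infinite values is infinite,
    so an integral that vanishes has finite positive and negative parts. *)
Lemma integrable_of_integral0 (h : T -> R) : measurable_fun setT h ->
  (\int[mu]_x (h x)%:E = 0)%E -> mu.-integrable setT (EFin \o h).
Proof.
move=> mh h0; apply/integrableP; split; first exact/measurable_EFinP.
by rewrite integral_fin_num_abs// ?h0//; exact/measurable_EFinP.
Qed.

Lemma L2diamond_lin a f g : L2diamond mu f -> L2diamond mu g ->
  L2diamond mu (fun x => mkK k a 0 * f x + g x).
Proof.
move=> [Lf [rf0 if0]] [Lg [rg0 ig0]].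
have [mrf mif] := L2_measurable Lf; have [mrg mig] := L2_measurable Lg.
split; first exact: L2D (L2Z a Lf) Lg.
have int0 (u v : T -> R) : measurable_fun setT u -> measurable_fun setT v ->
    (\int[mu]_x (u x)%:E = 0)%E -> (\int[mu]_x (v x)%:E = 0)%E ->
    (\int[mu]_x (a * u x + v x)%:E = 0)%E.
  move=> mu_ mv u0 v0.
  have iu := integrable_of_integral0 mu_ u0.
  have iv := integrable_of_integral0 mv v0.
  under eq_integral do rewrite EFinD EFinM.
  rewrite integralD//; last exact: integrableZl.
  by rewrite integralZl// u0 v0 mule0 adde0.
split.
- by under eq_integral do rewrite reKD reKZ; exact: int0.
- by under eq_integral do rewrite imKD imKZ; exact: int0.
Qed.

Lemma opnorm_lt A e : (opnorm mu A < e%:E)%E ->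
  exists c, [/\ 0 <= c, c < e & forall f, L2diamond mu f ->
    (L2norm mu (A f) <= c%:E * L2norm mu f)%E].
Proof.
move=> /ereal_inf_lt[_ [c [c0 cA] <-]]; rewrite lte_fin => ce.
by exists c.
Qed.

(** The infimum defining the operator norm need not be attained, so the bound
    is first proved for constants larger than [c]. The second argument [g]
    is meant to be [f] or [rotate f]. *)
Lemma opnorm_form A c f g : (opnorm mu A <= c%:E)%E ->
  L2diamond mu f -> L2 mu (A f) -> L2 mu g -> rip mu g g <= rip mu f f ->
  `|rip mu (A f) g| <= c * rip mu f f.
Proof.
move=> Ac df LAf Lg gf; have [Lf _] := df.
have b0 := rip_ge0 mu f.
have b1 : 0 < rip mu f f + 1 by lra.
apply/ler_addgt0Pr => eta eta0.
have : (opnorm mu A < (c + eta / (rip mu f f + 1))%:E)%E.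
  by rewrite (le_lt_trans Ac)// lte_fin ltrDl divr_gt0.
move=> /opnorm_lt[c' [c'0 c'e Ac']].
apply: le_trans (cauchy_schwarz_rip LAf Lg c'0 _ gf) _.
  by apply: rip_le_of_norm => //; exact: Ac'.
apply: (@le_trans _ _ ((c + eta / (rip mu f f + 1)) * rip mu f f)).
  by rewrite ler_wpM2r// ltW.
rewrite mulrDl lerD2l -mulrA ger_pMr// mulrC ler_pdivrMr//; lra.
Qed.

Lemma bounded_opP A : bounded_op mu A -> exists2 c, 0 < c &
  forall f, L2diamond mu f -> rip mu (A f) (A f) <= c ^+ 2 * rip mu f f.
Proof.
move=> [AD _ Afin].
have [c Ac] : exists c, (opnorm mu A < c%:E)%E.
  move: Afin; case: (opnorm mu A) => [r _| // | _]; last by exists 0; rewrite ltNyr.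
  by exists (r + 1); rewrite lte_fin ltrDl.
have [c' [c'0 c'c H]] := opnorm_lt Ac.
exists c; first exact: le_lt_trans c'c.
move=> f df; have [Lf _] := df; have [LAf _] := AD _ df.
apply: le_trans (rip_le_of_norm c'0 Lf LAf (H f df)) _.
by rewrite ler_wpM2r ?rip_ge0// lerXn2r ?nnegrE// ?ltW// (le_lt_trans c'0).
Qed.

Lemma selfadjoint_rip A f g : selfadjoint_op mu A ->
  L2diamond mu f -> L2diamond mu g -> rip mu (A f) g = rip mu f (A g).
Proof. by move=> sA df dg; rewrite -!reK_ip sA. Qed.

Lemma selfadjoint_form_real A f : selfadjoint_op mu A ->
  L2diamond mu f -> L2 mu (A f) -> rip mu (A f) (rotate f) = 0.
Proof.
move=> sA df LAf; have [Lf _] := df; have := congr1 (@imK _ _) (sA f f df df).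
by rewrite !imK_ip (rip_rotateC Lf LAf); lra.
Qed.

(** Let [g = A f - a f]. The form of [A - a] is nonnegative at [f + t g]; the
    coefficient of [2 t] there is the squared norm of [g], and the coefficient
    of [t ^+ 2] is at most [C] times it. Taking [t = - C^-1] bounds the squared
    norm of [g] by [C] times the form at [f], and [f], being the image of [g]
    under the bounded inverse, is controlled by [g]. *)
Lemma coercive_of_resolvent A a : bounded_op mu A -> selfadjoint_op mu A ->
  (forall f, L2diamond mu f -> a * rip mu f f <= rip mu (A f) f) ->
  ~ spectrum mu A (mkK k a 0) ->
  exists2 e, 0 < e &
    forall f, L2diamond mu f -> (a + e) * rip mu f f <= rip mu (A f) f.
Proof.
move=> bA sA Aa /contrapT[B [bB AB]].
have [c c0 cA] := bounded_opP bA; have [b b0 cB] := bounded_opP bB.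
have [AD Alin _] := bA; have [BD _ _] := bB.
pose C := c + `|a|.
have C0 : 0 < C by rewrite ltr_pwDl.
have D0 : 0 < b ^+ 2 * C by rewrite mulr_gt0// exprn_gt0.
exists (b ^+ 2 * C)^-1; first by rewrite invr_gt0.
move=> f df.
pose g : T -> K := fun x => A f x - mkK k a 0 * f x.
have [Lf _] := df; have dAf := AD _ df; have [LAf _] := dAf.
have gE : g = fun x => mkK k (- a) 0 * f x + A f x.
  apply/funext => x; apply: scalar_ext.
  - by rewrite /g !reKD reKN !reKZ; ring.
  - by rewrite /g !imKD imKN !imKZ; ring.
have dg : L2diamond mu g by rewrite gE; exact: L2diamond_lin.
have [Lg _] := dg; have dAg := AD _ dg; have [LAg _] := dAg.
have ng0 := rip_ge0 mu g.
have Lsf s : L2 mu (fun x => mkK k s 0 * f x) := L2Z s Lf.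
have rip_g u : L2 mu u -> rip mu g u = rip mu (A f) u - a * rip mu f u.
  by move=> Lu; rewrite /g ripBl// -[fun x => mkK k a 0 * _]/(scalef a f) ripZl.
(* the nonnegative form of A - a, evaluated at f + t g *)
have form t : 0 <= t ^+ 2 * (rip mu (A g) g - a * rip mu g g)
    + 2 * t * rip mu g g + (rip mu (A f) f - a * rip mu f f).
  pose h : T -> K := fun x => mkK k t 0 * g x + f x.
  have dh : L2diamond mu h by exact: L2diamond_lin.
  have [Lh _] := dh; have [LAh _] := AD _ dh.
  have Ltg : L2 mu (scalef t g) by exact: L2Z.
  have LtAg : L2 mu (scalef t (A g)) by exact: L2Z.
  have hr u : L2 mu u -> rip mu u h = t * rip mu u g + rip mu u f.
    by move=> Lu; rewrite ripDr// -[fun x => mkK k t 0 * _]/(scalef t g) ripZr.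
  have hhE : rip mu h h = t ^+ 2 * rip mu g g + 2 * t * rip mu g f + rip mu f f.
    by rewrite hr// (ripC _ h g) (ripC _ h f) !hr// (ripC _ f g); ring.
  have AhE : rip mu (A h) h =
      t ^+ 2 * rip mu (A g) g + 2 * t * rip mu (A f) g + rip mu (A f) f.
    rewrite (eq_rip_ae LAh (L2D LtAg LAf) Lh (Alin (mkK k t 0) g f dg df)).
    rewrite ripDl// ripZl// !hr// (selfadjoint_rip sA dg df) (ripC _ g (A f)).
    by ring.
  have := Aa h dh; rewrite hhE AhE.
  by rewrite (rip_g g Lg) (ripC _ g f); lra.
have Sg : rip mu (A g) g - a * rip mu g g <= C * rip mu g g.
  have := cauchy_schwarz_rip LAg Lg (ltW c0) (cA g dg) (lexx _).
  have : - (`|a| * rip mu g g) <= a * rip mu g g.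
    by rewrite -mulNr ler_wpM2r// lerNl -normrN ler_norm.
  by move=> h1 /(le_trans (ler_norm _)); rewrite /C mulrDl; lra.
have gQ : rip mu g g <= C * (rip mu (A f) f - a * rip mu f f).
  have CS : C^-1 ^+ 2 * (rip mu (A g) g - a * rip mu g g) <= C^-1 * rip mu g g.
    rewrite expr2 -mulrA ler_wpM2l ?invr_ge0 ?(ltW C0)//.
    by rewrite ler_pdivrMl.
  rewrite -ler_pdivrMl//; have := form (- C^-1); rewrite sqrrN.
  move: CS; move: (_ ^+ 2 * _) (rip mu (A f) f - _) => S Q.
  lra.
(* f is the image of g under the bounded inverse, up to a null set *)
have fg : rip mu f f <= b ^+ 2 * rip mu g g.
  have [BDg _] := BD _ dg; have [Bf _] := AB f df.
  rewrite -(eq_rip_ae BDg Lf Lf Bf) ripC -(eq_rip_ae BDg Lf BDg Bf).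
  exact: cB.
rewrite mulrDl -lerBrDl ler_pdivrMl// -mulrA.
by apply: le_trans fg _; rewrite ler_wpM2l// sqr_ge0.
Qed.

(** The infimum of the Rayleigh quotient belongs to the spectrum, since
    otherwise [coercive_of_resolvent] would improve it as a lower bound. Currents
    of norm zero have no quotient; there the form vanishes. *)
Lemma inf_spectrum_form A m f : bounded_op mu A -> selfadjoint_op mu A ->
  (m%:E <= inf_spectrum mu A)%E -> L2diamond mu f ->
  m * rip mu f f <= rip mu (A f) f.
Proof.
move=> bA sA mA df; rewrite leNgt; apply/negP => fm.
have [AD _ _] := bA; have [c c0 cA] := bounded_opP bA.
have lowA g : L2diamond mu g -> - c * rip mu g g <= rip mu (A g) g.
  move=> dg; have [Lg _] := dg; have [LAg _] := AD _ dg.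
  have := cauchy_schwarz_rip LAg Lg (ltW c0) (cA g dg) (lexx _).
  by rewrite ler_norml mulNr => /andP[].
have nf : 0 < rip mu f f.
  rewrite lt_neqAle rip_ge0 andbT; apply/eqP => f0.
  by have := lowA f df; move: fm; rewrite -f0; lra.
pose S := [set rip mu (A g) g / rip mu g g |
  g in [set g | L2diamond mu g /\ 0 < rip mu g g]].
have Sf : S (rip mu (A f) f / rip mu f f) by exists f.
have Slow : lbound S (- c).
  by move=> _ [g [dg g0] <-]; rewrite ler_pdivlMr//; exact: lowA.
have hS : has_inf S by split; [exists (rip mu (A f) f / rip mu f f)|exists (- c)].
have Slb g : L2diamond mu g -> inf S * rip mu g g <= rip mu (A g) g.
  move=> dg; have := rip_ge0 mu g; rewrite le_eqVlt => /predU1P[g0|g0].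
    by have := lowA g dg; rewrite -g0; lra.
  by rewrite -ler_pdivlMr//; apply: (ge_inf hS.2); exists g.
have infm : inf S < m.
  by apply: (le_lt_trans (ge_inf hS.2 Sf)); rewrite ltr_pdivrMr.
have nspec : ~ spectrum mu A (mkK k (inf S) 0).
  move=> sp; have : (inf_spectrum mu A <= (inf S)%:E)%E.
    by apply: ereal_inf_lbound; exists (inf S).
  by move=> /(le_trans mA); rewrite lee_fin leNgt infm.
have [e e0 eA] := coercive_of_resolvent bA sA Slb nspec.
have : inf S + e <= inf S.
  apply: lb_le_inf; first by exists (rip mu (A f) f / rip mu f f).
  by move=> _ [g [dg g0] <-]; rewrite ler_pdivlMr//; exact: eA.
by rewrite gerDl leNgt e0.
Qed.

End Operators.

(** * Closed sets are measurable for the volume *)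

Section BoxMeasure.
Context (R : realType) (d : nat).
Local Notation E := 'rV[R]_d.
Implicit Types (A X : set E) (a b x : E).

Let box a b : set E := [set x | forall i, a 0 i <= x 0 i <= b 0 i].

Let below (i : 'I_d) (c : R) : set E := [set x | x 0 i <= c].
Let above (i : 'I_d) (c : R) : set E := [set x | c <= x 0 i].

Lemma box_gauge_box a b : (forall i, a 0 i <= b 0 i) ->
  (box_gauge (box a b) <= (\prod_(i < d) (b 0 i - a 0 i))%:E)%E.
Proof.
move=> ab; rewrite /box_gauge; case: asboolP => _.
  by rewrite lee_fin; apply: prodr_ge0 => i _; rewrite subr_ge0.
by apply: ereal_inf_lbound; exists (a, b).
Qed.

(** A coordinate hyperplane cuts a closed box into two closed boxes, whose
    volumes add up; the common face does no harm because it has volume zero.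
    A set that is neither empty nor a box has infinite gauge. *)
Lemma box_gauge_split A i c :
  (box_gauge (A `&` below i c) + box_gauge (A `&` above i c) <= box_gauge A)%E.
Proof.
have [->|A0] := eqVneq A set0; first by rewrite !set0I box_gauge0 adde0.
rewrite [leRHS]/box_gauge; case: asboolP => [/eqP|_]; first by rewrite (negbTE A0).
apply: le_ereal_inf_tmp => _ [[a b] [/= ab AE] <-].
have gA := box_gauge_box ab; rewrite -[box a b]AE in gA.
have [ca|ac] := ltP c (a 0 i).
  have -> : A `&` below i c = set0.
    rewrite -subset0 AE => x [/(_ i)/andP[ax _] xc].
    by move: (le_lt_trans (le_trans ax xc) ca); rewrite ltxx.
  by rewrite box_gauge0 add0e; rewrite setIidl// AE => x /(_ i)/andP[/(le_trans (ltW ca))].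
have [bc|cb] := ltP (b 0 i) c.
  have -> : A `&` above i c = set0.
    rewrite -subset0 AE => x [/(_ i)/andP[_ xb] cx].
    by move: (le_lt_trans (le_trans cx xb) bc); rewrite ltxx.
  rewrite box_gauge0 adde0; rewrite setIidl// AE => x /(_ i)/andP[_ xb].
  exact: le_trans xb (ltW bc).
(* the corners of the two pieces: a coordinate is moved to c *)
have upd (x : E) : exists x' : E, x' 0 i = c /\ forall j, j != i -> x' 0 j = x 0 j.
  exists (\row_j (if j == i then c else x 0 j)); split=> [|j /negbTE ji].
    by rewrite mxE eqxx.
  by rewrite mxE ji.
have [[a' [a'i a'j]] [b' [b'i b'j]]] := (upd a, upd b).
have -> : A `&` below i c = box a b'.
  rewrite AE; apply/seteqP; split => [x [xab xc] j|x xab].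
    by have [->|ji] := eqVneq j i; rewrite ?b'i ?b'j// xc andbT; have /andP[] := xab i.
  have := xab i; rewrite b'i => /andP[_ xc]; split => // j.
  have [->|ji] := eqVneq j i; last by have := xab j; rewrite b'j.
  by have /andP[-> _] := xab i; exact: le_trans xc cb.
have -> : A `&` above i c = box a' b.
  rewrite AE; apply/seteqP; split => [x [xab xc] j|x xab].
    by have [->|ji] := eqVneq j i; rewrite ?a'i ?a'j// xc; have /andP[] := xab i.
  have := xab i; rewrite a'i => /andP[xc _]; split => // j.
  have [->|ji] := eqVneq j i; last by have := xab j; rewrite a'j.
  by have /andP[_ ->] := xab i; rewrite (le_trans ac).
apply: le_trans (leeD (box_gauge_box _) (box_gauge_box _)) _.
- by move=> j; have [->|ji] := eqVneq j i; [rewrite b'i|rewrite b'j].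
- by move=> j; have [->|ji] := eqVneq j i; [rewrite a'i|rewrite a'j].
rewrite -EFinD lee_fin (bigD1 i)//= [X in _ + X <= _](bigD1 i)//= [leRHS](bigD1 i)//=.
rewrite a'i b'i.
rewrite (eq_bigr (fun j => b 0 j - a 0 j)); last by move=> j ji; rewrite b'j.
rewrite [X in _ + _ * X](eq_bigr (fun j => b 0 j - a 0 j)); last first.
  by move=> j ji; rewrite a'j.
by rewrite -mulrDl addrC addrA subrK.
Qed.

(** Cutting every member of a cover of [X] gives covers of the two pieces. *)
Lemma lebesgue_outer_split X i c :
  (lebesgue_outer (X `&` below i c) + lebesgue_outer (X `&` above i c)
    <= lebesgue_outer X)%E.
Proof.
apply: le_ereal_inf_tmp => _ [F XF <-].
have cover (H : set E) :
    (lebesgue_outer (X `&` H) <= \sum_(n <oo) box_gauge (F n `&` H))%E.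
  apply: ereal_inf_lbound; exists (fun n => F n `&` H) => //=.
  by rewrite -setI_bigcupl; exact: setSI.
apply: le_trans (leeD (cover _) (cover _)) _.
rewrite -nneseriesD; try by move=> *; exact: box_gauge_ge0.
apply: lee_nneseries => [n _ _|n _]; first by rewrite adde_ge0 ?box_gauge_ge0.
exact: box_gauge_split.
Qed.

(** The closed half-spaces [below i c] and [above i c] overlap, but each contains
    the complement of the other, so measurability follows from
    [lebesgue_outer_split] by monotonicity. *)
Lemma below_caratheodory i c : (@lebesgue_outer R d).-caratheodory (below i c).
Proof.
apply: (@le_caratheodory_measurable R E (@lebesgue_outer R d)) => X.
apply: le_trans (lebesgue_outer_split X i c); rewrite leeD2l//.
apply: le_outer_measure; apply: setIS => x /= /negP.
by rewrite /below /above /= -ltNge => /ltW.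
Qed.

Lemma above_caratheodory i c : (@lebesgue_outer R d).-caratheodory (above i c).
Proof.
apply: (@le_caratheodory_measurable R E (@lebesgue_outer R d)) => X.
apply: le_trans (lebesgue_outer_split X i c); rewrite addeC leeD2r//.
apply: le_outer_measure; apply: setIS => x /= /negP.
by rewrite /below /above /= -ltNge => /ltW.
Qed.

Lemma box_caratheodory a b : (@lebesgue_outer R d).-caratheodory (box a b).
Proof.
have -> : box a b = \bigcap_(i in [set: 'I_d]) (above i (a 0 i) `&` below i (b 0 i)).
  apply/seteqP; split => [x xab i _|x xab i].
    by have /andP[] := xab i.
  by have [] := xab i I; rewrite /above /below /= => -> ->.
apply: (@fin_bigcap_measurable _ (caratheodory_type (@lebesgue_outer R d))).
  exact: finite_finset.
move=> i _; apply: (@measurableI _ (caratheodory_type (@lebesgue_outer R d))).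
- exact: above_caratheodory.
- exact: below_caratheodory.
Qed.

(** An open set is the union of the cubes with rational centre and radius
    [1 / (m + 1)] that it contains, and these are countably many. *)
Lemma open_caratheodory (U : set E) : open U -> (@lebesgue_outer R d).-caratheodory U.
Proof.
move=> oU.
pose cube (q : 'rV[rat]_d * nat) : set E :=
  box (\row_i (ratr (q.1 0 i) - q.2.+1%:R^-1)) (\row_i (ratr (q.1 0 i) + q.2.+1%:R^-1)).
pose F q := if `[< cube q `<=` U >] then cube q else set0.
have -> : U = \bigcup_q F q.
  apply/seteqP; split => [x Ux|x [q _]]; last first.
    by rewrite /F; case: asboolP => // + qx; exact.
  have /nbhs_ballP[e /= e0 eU] : nbhs x U by exact: open_nbhs_nbhs.
  have e2 : 0 < e / 2 by rewrite divr_gt0.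
  have [m] := ltr_add_invr e2; rewrite add0r => me.
  have m0 : 0 < m.+1%:R^-1 :> R by rewrite invr_gt0 ltr0n.
  have /choice[r rx] : forall i, exists q : rat,
      ratr q \in `]x 0 i - m.+1%:R^-1, x 0 i + m.+1%:R^-1[.
    by move=> i; apply: rat_in_itvoo; rewrite ltrD2l gtrN.
  have near i : `|x 0 i - ratr (r i)| <= m.+1%:R^-1.
    by have := rx i; rewrite in_itv/= ler_distlC => /andP[/ltW -> /ltW ->].
  exists (\row_i r i, m) => //; rewrite /F asboolT /=.
    by move=> i; rewrite !mxE; have := near i; rewrite ler_distl.
  move=> y yq; apply: eU; split=> // j i; rewrite ord1 {j}.
  have := yq i; rewrite !mxE /= -ler_distl => yr.
  rewrite -ball_normE /ball_ /=.
  rewrite -(subrKA (ratr (r i))) (le_lt_trans (ler_normD _ _))//; rewrite distrC in yr.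
  by rewrite [ltRHS]splitr (le_lt_trans (lerD (near i) yr)) ?ltrD.
apply: (@countable_bigcupT_measurable _ (caratheodory_type (@lebesgue_outer R d))).
  exact: countableP.
move=> q; rewrite /F; case: asboolP => _; first exact: box_caratheodory.
exact: (@measurable0 _ (caratheodory_type (@lebesgue_outer R d))).
Qed.

Lemma closed_volume_measurable (Omega C : set E) : closed C ->
  (volume_outer Omega).-caratheodory C.
Proof.
move=> cC X; rewrite /volume_outer /= /restr_outer.
have := caratheodory_measurable_setC (open_caratheodory (closed_openC cC)).
by rewrite setCK => /(_ (X `&` Omega)) ->; rewrite (setIAC X Omega C) (setIAC X Omega).
Qed.

End BoxMeasure.

(** * Differences of operators *)

Section OperatorAlgebra.
Context (d : measure_display) (T : measurableType d) (R : realType).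
Variables (mu : {measure set T -> \bar R}) (k : scalars).
Local Notation K := (Defs.scalar R k).
Implicit Types (A B : oper T R k) (f g : T -> K).

Lemma norm_le_of_rip (c : R) f g : 0 <= c -> L2 mu f -> L2 mu g ->
  rip mu g g <= c ^+ 2 * rip mu f f -> (L2norm mu g <= c%:E * L2norm mu f)%E.
Proof.
move=> c0 Lf Lg gf.
have sqrtK (y : \bar R) : (0 <= y -> (y `^ 2) `^ 2^-1 = y)%E.
  by move=> y0; rewrite -poweRrM mulfV// poweRe1.
have Lf0 : (0 <= L2norm mu f)%E by exact: Lnorm_ge0.
have Lg0 : (0 <= L2norm mu g)%E by exact: Lnorm_ge0.
have cf0 : (0 <= c%:E * L2norm mu f)%E by rewrite mule_ge0 ?lee_fin.
rewrite -[leLHS]sqrtK// -[leRHS]sqrtK//.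
rewrite gt0_ler_poweR ?in_itv/= ?leey ?poweR_ge0 ?andbT ?invr_ge0//.
rewrite poweRM ?lee_fin// !L2norm_sqr// poweR_EFin powR_mulrn//.
Qed.

Lemma L2diamondB f g : L2diamond mu f -> L2diamond mu g ->
  L2diamond mu (fun x => f x - g x).
Proof.
move=> df dg; have -> : (fun x => f x - g x) = (fun x => mkK k (-1) 0 * g x + f x).
  apply/funext => x; apply: scalar_ext.
  - by rewrite !reKD reKN reKZ; ring.
  - by rewrite !imKD imKN imKZ; ring.
exact: L2diamond_lin.
Qed.

Lemma bounded_op_sub A B : bounded_op mu A -> bounded_op mu B ->
  bounded_op mu (op_sub A B).
Proof.
move=> bA bB; have [AD Alin _] := bA; have [BD Blin _] := bB.
have [a a0 cA] := bounded_opP bA; have [b b0 cB] := bounded_opP bB.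
split.
- by move=> f df; apply: L2diamondB; [exact: AD|exact: BD].
- move=> c f g df dg; have := Alin c f g df dg; have := Blin c f g df dg.
  by apply: filterS2 => x HB HA; rewrite /op_sub HB HA; ring.
- apply: (@le_lt_trans _ _ (2 * (a + b))%:E); last exact: ltry.
  apply: ereal_inf_lbound; exists (2 * (a + b)) => //; split.
    by rewrite mulr_ge0// addr_ge0// ltW.
  move=> f df; have [Lf _] := df; have [LAf _] := AD f df; have [LBf _] := BD f df.
  apply: norm_le_of_rip => //; first by rewrite mulr_ge0// addr_ge0// ltW.
    exact: L2B.
  (* the squared norm of u - v is at most twice the sum of those of u and v *)
  have sum0 : 0 <= rip mu (A f) (A f) + 2 * rip mu (A f) (B f) + rip mu (B f) (B f).
    have := rip_ge0 mu (fun x => A f x + B f x); rewrite ripDl//; last exact: L2D.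
    by rewrite !ripDr// (ripC _ (B f)); lra.
  have -> : rip mu (op_sub A B f) (op_sub A B f) =
      rip mu (A f) (A f) - 2 * rip mu (A f) (B f) + rip mu (B f) (B f).
    rewrite [LHS](ripBl LAf LBf (L2B LAf LBf)) !(ripC _ _ (fun x => _ - _)) !ripBl//.
    by rewrite (ripC _ (B f) (A f)); ring.
  have := cA f df; have := cB f df; have := rip_ge0 mu f; move: sum0.
  move: (rip _ (A f) (B f)) (rip _ (A f) (A f)) (rip _ (B f) (B f)) (rip _ f f) => u v w n.
  move=> uvw n0 wb va.
  apply: (@le_trans _ _ (2 * (a ^+ 2 * n) + 2 * (b ^+ 2 * n))); first lra.
  rewrite -subr_ge0 (_ : _ - _ = (2 * a ^+ 2 + 2 * b ^+ 2 + 8 * (a * b)) * n); last by ring.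
  by rewrite mulr_ge0// !addr_ge0// !mulr_ge0// ?sqr_ge0// ltW.
Qed.

Lemma selfadjoint_op_sub A B :
  (forall f, L2diamond mu f -> L2 mu (A f)) ->
  (forall f, L2diamond mu f -> L2 mu (B f)) ->
  selfadjoint_op mu A -> selfadjoint_op mu B -> selfadjoint_op mu (op_sub A B).
Proof.
move=> AL BL sA sB f g df dg.
have [Lf _] := df; have [Lg _] := dg.
have [LAf LBf LAg LBg] := And4 (AL f df) (BL f df) (AL g dg) (BL g dg).
have [rg rAg rBg] := And3 (L2_rotate Lg) (L2_rotate LAg) (L2_rotate LBg).
have rf := L2_rotate Lf.
apply: scalar_ext; rewrite ?reK_ip ?imK_ip /op_sub.
- rewrite ripBl// ripC [RHS]ripC ripBl//.
  have := congr1 (@reK _ _) (sA f g df dg); have := congr1 (@reK _ _) (sB f g df dg).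
  by rewrite !reK_ip (ripC _ g) => -> ->; rewrite !(ripC _ f).
- rewrite ripBl// (rip_rotateC Lf (L2B LAg LBg)) ripBl//.
  have := congr1 (@imK _ _) (sA f g df dg); have := congr1 (@imK _ _) (sB f g df dg).
  rewrite !imK_ip => -> ->.
  by rewrite (rip_rotateC Lf LAg) (rip_rotateC Lf LBg); ring.
Qed.

End OperatorAlgebra.

(** * Conductivities perturbed on a closed set *)

Section PerturbedConductivities.
Context (R : realType) (d : nat) (Omega : set 'rV[R]_d).
Local Notation E := 'rV[R]_d.

(** The conductivity whose model [Top] compares with the measurement. *)
Definition perturbed (gamma0 : E -> R) (beta betaL : R) (s : sgn) (C : set E) : E -> R :=
  match s with
  | Plus => fun x => gamma0 x + beta * \1_C x
  | Minus => fun x => gamma0 x - beta / (1 + beta) * betaL * \1_C x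
  end.

Lemma Linf_add_indic (w : E -> R) (b : R) (C : set E) : closed C ->
  w \in Lfun (volume Omega) +oo%E ->
  (fun x => w x + b * \1_C x) \in Lfun (volume Omega) +oo%E.
Proof.
move=> cC Lw; apply: LfunD => //; first exact: leey.
rewrite inE; apply/andP; split; rewrite inE /=.
  apply: measurable_funM => //.
  exact: (@measurable_indic _ (caratheodory_type (volume_outer Omega)) _ _ _
    (closed_volume_measurable Omega cC)).
rewrite /finite_norm unlock /Lnorm; case: ifPn => // _.
apply: (@le_lt_trans _ _ `|b|%:E); last exact: ltry.
apply/ess_supP; apply: nearW => x /=; rewrite lee_fin normrM indicE.
by case: (_ \in _); rewrite ?normr1 ?normr0 ?mulr1 ?mulr0.
Qed.

(** For the minus sign, [betaL] being a lower bound of [gamma0] leaves at least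
    [betaL - beta / (1 + beta) * betaL = betaL / (1 + beta)]. *)
Lemma Linf_plus_perturbed (gamma0 : E -> R) (beta betaL : R) s C : closed C ->
  Linf_plus Omega gamma0 -> 0 < betaL ->
  (\forall x \ae volume Omega, betaL <= gamma0 x) -> 0 < beta ->
  Linf_plus Omega (perturbed gamma0 beta betaL s C).
Proof.
move=> cC [Lg0 g0] bL0 bL b0; case: s; split=> /=.
- exact: Linf_add_indic.
- apply: lt_le_trans g0 _; apply: le_ess_inf; apply: nearW => x.
  by rewrite lee_fin lerDl mulr_ge0// ?ltW// indicE.
- have -> : (fun x => gamma0 x - beta / (1 + beta) * betaL * \1_C x) =
    (fun x => gamma0 x + (- (beta / (1 + beta) * betaL)) * \1_C x).
    by apply/funext => x; rewrite mulNr.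
  exact: Linf_add_indic.
have b1 : 0 < 1 + beta by rewrite addr_gt0.
apply: (@lt_le_trans _ _ (betaL / (1 + beta))%:E); first by rewrite lte_fin divr_gt0.
apply/ess_infP; apply: (@filterS (caratheodory_type (volume_outer Omega)) _ _ _ _ _ bL) => x bx; rewrite lee_fin.
have -> : betaL / (1 + beta) = betaL - beta / (1 + beta) * betaL by field; rewrite gt_eqF.
by rewrite lerB// ler_piMr// mulr_ge0 ?divr_ge0 ?ltW.
Qed.

End PerturbedConductivities.

(** * Set limits and small numbers *)

(** The lower limit is contained in the upper one, and the intersection over
    all parameters in both; so it suffices that the lower limit contain [L],
    in the strong sense of the first premise, and that [L] contain the upper
    limit. *)
Lemma set_limit_squeeze (R : realType) (X : Type) (S : R -> R -> set X) (L : set X) :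
  (forall h delta, 0 < h -> 0 < delta -> L `<=` S h delta) ->
  (forall x, (forall e, 0 < e -> exists h delta,
     [/\ 0 < h <= e, 0 < delta <= e & S h delta x]) -> L x) ->
  set_limit S L /\
  L = \bigcap_(p in [set p : R * R | 0 < p.1 /\ 0 < p.2]) S p.1 p.2.
Proof.
move=> LS SL.
have often x : (\bigcap_(e in [set e : R | 0 < e])
    \bigcup_(p in [set p : R * R | 0 < p.1 <= e /\ 0 < p.2 <= e]) S p.1 p.2) x -> L x.
  move=> H; apply: SL => e e0; have [[h delta] /= [he de] Sx] := H e e0.
  by exists h, delta.
split; first split.
- apply/seteqP; split=> [x [e /= e0 H]|x Lx].
    apply: SL => e' e'0; have m0 : 0 < Num.min e e' by rewrite lt_min e0.
    exists (Num.min e e'), (Num.min e e'); rewrite m0 !ge_min lexx orbT; split=> //.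
    by apply: (H (_, _)); rewrite /= m0 ge_min lexx.
  exists 1 => //= p [/andP[p1 _] /andP[p2 _]]; exact: LS.
- apply/seteqP; split=> [x Lx e /= e0|x]; last exact: often.
  by exists (e, e); rewrite /= ?e0 ?lexx//; exact: LS.
- apply/seteqP; split=> [x Lx p [p1 p2]|x H]; first exact: LS.
  by apply: often => e /= e0; exists (e, e); rewrite /= ?e0 ?lexx//; exact: (H (e, e) (conj e0 e0)).
Qed.

Lemma le0_of_small (R : realType) (x K : R) : 0 <= K ->
  (forall e, 0 < e -> x <= e * K) -> x <= 0.
Proof.
move=> K0 H; apply/ler_addgt0Pr => e e0; rewrite add0r.
have K1 : 0 < K + 1 by rewrite ltr_wpDl.
apply: (le_trans (H (e / (K + 1)) (divr_gt0 e0 K1))).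
by rewrite -mulrA ger_pMr// mulrC ler_pdivrMr// mul1r lerDl.
Qed.

(** * The forms of the exact, discretized and noisy operators *)

Section NtDForms.
Context (R : realType) (d : nat) (k : scalars) (Omega : set 'rV[R]_d).
Local Notation E := 'rV[R]_d.
Local Notation sigma := (surface Omega).
Local Notation op := (oper (caratheodory_type (surface_outer Omega)) R k).
Local Notation fct := (caratheodory_type (surface_outer Omega) -> Defs.scalar R k).

(** Either a weak solution exists, and its trace is square-integrable by
    definition, or the value is the default function 0. *)
Lemma L2_NtD (w : E -> R) (f : fct) : L2 sigma (NtD w f).
Proof.
rewrite /NtD; case: xgetP => [t _ [u [g [[_ Lt _] _ _]]]|_]; first exact: Lt.
exact: L2_cst0.
Qed.

Definition Linf_norm (w : E -> R) : R := fine ('N[volume Omega]_+oo [EFin \o w]).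

Lemma model_error_form (Lambdah : R -> (E -> R) -> op) (omega : R -> R) h w (f g : fct) :
  approximate_model Lambdah omega -> 0 < h -> Linf_plus Omega w ->
  L2diamond sigma f -> L2 sigma g -> rip sigma g g <= rip sigma f f ->
  `|rip sigma (NtD w f) g - rip sigma (Lambdah h w f) g| <=
    `|omega h| * Linf_norm w * rip sigma f f.
Proof.
move=> [app _] h0 Lw df Lg gf; have [[LD _ _] _ _ err] := app h w h0 Lw.
have LNf := L2_NtD w f; have [LLf _] := LD f df.
have Lwfin : ('N[volume Omega]_+oo [EFin \o w] \is a fin_num)%E.
  rewrite ge0_fin_numE ?Lnorm_ge0//.
  by have /sub_Lfun_finLfun := Lw.1; rewrite inE.
rewrite -ripBl//; apply: (opnorm_form (A := op_sub (NtD w) (Lambdah h w))) => //.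
  apply: (le_trans err); rewrite EFinM /Linf_norm fineK//.
  by rewrite lee_wpmul2r ?Lnorm_ge0// lee_fin ler_norm.
exact: L2B.
Qed.

Definition sgnR (s : sgn) : R := if s is Plus then 1 else -1.

Lemma normr_sgnR s : `|sgnR s| = 1.
Proof. by case: s; rewrite /= ?normrN normr1. Qed.

Lemma rip_Top (gamma0 : E -> R) beta betaL (Lmeas : op) (L : (E -> R) -> op) s C
    (f g : fct) :
  L2 sigma (Lmeas f) -> L2 sigma (L (perturbed gamma0 beta betaL s C) f) -> L2 sigma g ->
  L2 sigma (Top gamma0 beta betaL Lmeas L s C f) /\
  rip sigma (Top gamma0 beta betaL Lmeas L s C f) g =
  sgnR s * (rip sigma (Lmeas f) g
            - rip sigma (L (perturbed gamma0 beta betaL s C) f) g).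
Proof.
case: s => /= L1 L2' Lg; split; try exact: L2B.
- by rewrite mul1r; exact: ripBl.
- by rewrite mulN1r opprB; exact: ripBl.
Qed.

(** Shifting by a real multiple of the identity moves the real part of the form
    only: [rip f (rotate f)] vanishes by antisymmetry. *)
Lemma pos_op_shiftP (A : op) (a : R) :
  (forall f, L2diamond sigma f -> L2 sigma (A f)) ->
  pos_op sigma (op_add A (op_scal (mkK k a 0))) <->
  forall f, L2diamond sigma f ->
    0 <= rip sigma (A f) f + a * rip sigma f f /\ rip sigma (A f) (rotate f) = 0.
Proof.
move=> AL; have shift f : L2diamond sigma f ->
    rip sigma (op_add A (op_scal (mkK k a 0)) f) f
      = rip sigma (A f) f + a * rip sigma f f /\
    rip sigma (op_add A (op_scal (mkK k a 0)) f) (rotate f)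
      = rip sigma (A f) (rotate f).
  move=> df; have [Lf _] := df; have LAf := AL f df; have Laf := L2Z a Lf.
  have Lrf := L2_rotate Lf.
  split; first by rewrite [LHS](ripDl LAf Laf Lf) ripZl.
  rewrite [LHS](ripDl LAf Laf Lrf) ripZl//.
  have -> : rip sigma f (rotate f) = 0 by have := rip_rotateC Lf Lf; lra.
  by rewrite mulr0 addr0.
split=> H f df; have := H f df; have [sh1 sh2] := shift f df.
- by move/ip_ge0P; rewrite sh1 sh2.
- by move=> H'; apply/ip_ge0P; rewrite sh1 sh2.
Qed.

Section Comparison.
Variables (gamma0 gamma : E -> R) (beta betaL : R).
Variables (Lambdah : R -> (E -> R) -> op) (omega : R -> R) (N : R -> op).
Hypotheses (Lgamma0 : Linf_plus Omega gamma0) (Lgamma : Linf_plus Omega gamma).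
Hypotheses (betaL_gt0 : 0 < betaL) (beta_gt0 : 0 < beta).
Hypothesis gamma0_ge : \forall x \ae volume Omega, betaL <= gamma0 x.
Hypothesis model : approximate_model Lambdah omega.
Hypothesis noise : noise_model N.

Let T s C := Top gamma0 beta betaL (NtD gamma) (@NtD R d k Omega) s C.
Let Th h s C := Top gamma0 beta betaL (Lambdah h gamma) (Lambdah h) s C.
Let Thd h delta s C :=
  Top gamma0 beta betaL (op_add (Lambdah h gamma) (N delta)) (Lambdah h) s C.

Lemma noisy_form h delta s C (f g : fct) : 0 < h -> 0 < delta -> closed C ->
  L2diamond sigma f -> L2 sigma g ->
  L2 sigma (Thd h delta s C f) /\
  rip sigma (Thd h delta s C f) g
    = rip sigma (Th h s C f) g + sgnR s * rip sigma (N delta f) g.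
Proof.
move=> h0 delta0 cC df Lg.
have Lw := Linf_plus_perturbed s cC Lgamma0 betaL_gt0 gamma0_ge beta_gt0.
have [[DG _ _] _ _ _] := model.1 h gamma h0 Lgamma.
have [[DW _ _] _ _ _] := model.1 h _ h0 Lw.
have [[DN _ _] _ _] := noise delta0.
have [LG _] := DG f df; have [LW _] := DW f df; have [LN _] := DN f df.
have [Lt tE] := rip_Top (L := Lambdah h) (Lmeas := op_add (Lambdah h gamma) (N delta))
  (L2D LG LN) LW Lg.
have [_ hE] := rip_Top (L := Lambdah h) LG LW Lg.
by split=> //; rewrite [LHS]tE [in RHS]hE [X in X - _](ripDl LG LN Lg); ring.
Qed.

(** The form of the discretized operator is at least [delta - a] times the
    squared norm, by the spectral bound, and that of the noise at least
    [- delta] times it, whichever sign the noise enters with. *)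
Lemma noisy_test_passes h delta s C (a : R) : 0 < h -> 0 < delta -> closed C ->
  ((delta - a)%:E <= inf_spectrum sigma (Th h s C))%E ->
  pos_op sigma (op_add (Thd h delta s C) (op_scal (mkK k a 0))).
Proof.
move=> h0 delta0 cC spec.
have Lw := Linf_plus_perturbed s cC Lgamma0 betaL_gt0 gamma0_ge beta_gt0.
have [bG _ sG _] := model.1 h gamma h0 Lgamma.
have [bW _ sW _] := model.1 h _ h0 Lw.
have [bN sN nN] := noise delta0.
have [[DG _ _] [DW _ _] [DN _ _]] := And3 bG bW bN.
have LG f : L2diamond sigma f -> L2 sigma (Lambdah h gamma f) by move=> /DG[].
have LW f : L2diamond sigma f ->
  L2 sigma (Lambdah h (perturbed gamma0 beta betaL s C) f) by move=> /DW[].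
have bT : bounded_op sigma (Th h s C).
  by rewrite /Th; case: s {spec} Lw bW sW DW LW => *; exact: bounded_op_sub.
have sT : selfadjoint_op sigma (Th h s C).
  by rewrite /Th; case: s {spec} Lw bW sW DW LW bT => *; exact: selfadjoint_op_sub.
apply/pos_op_shiftP => f df; have [Lf _] := df.
  by have [] := noisy_form s h0 delta0 cC df Lf.
have [LNf _] := DN f df; have rf := L2_rotate Lf.
have [_ ->] := noisy_form s h0 delta0 cC df Lf.
have [_ ->] := noisy_form s h0 delta0 cC df rf.
have [LTf _] : L2diamond sigma (Th h s C f) by have [+ _ _] := bT; exact.
split; last first.
  by rewrite (selfadjoint_form_real sT df LTf) (selfadjoint_form_real sN df LNf) mulr0 addr0.
have := inf_spectrum_form bT sT spec df.
have := opnorm_form nN df LNf Lf (lexx _).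
have : - `|rip sigma (N delta f) f| <= sgnR s * rip sigma (N delta f) f.
  by rewrite lerNl (le_trans (ler_norm _))// normrN normrM normr_sgnR mul1r.
lra.
Qed.

Lemma noisy_form_error h delta s C (f g : fct) : 0 < h -> 0 < delta -> closed C ->
  L2diamond sigma f -> L2 sigma g -> rip sigma g g <= rip sigma f f ->
  `|rip sigma (T s C f) g - rip sigma (Thd h delta s C f) g| <=
    (`|omega h| * (Linf_norm gamma + Linf_norm (perturbed gamma0 beta betaL s C)) + delta)
      * rip sigma f f.
Proof.
move=> h0 delta0 cC df Lg gf.
have Lw := Linf_plus_perturbed s cC Lgamma0 betaL_gt0 gamma0_ge beta_gt0.
have [[DG _ _] _ _ _] := model.1 h gamma h0 Lgamma.
have [[DW _ _] _ _ _] := model.1 h _ h0 Lw.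
have [[DN _ _] _ nN] := noise delta0.
have [LG _] := DG f df; have [LW _] := DW f df; have [LN _] := DN f df.
have [_ ->] := noisy_form s h0 delta0 cC df Lg.
have [_ ->] := rip_Top (L := Lambdah h) LG LW Lg.
have [_ ->] := rip_Top (L := @NtD R d k Omega) (L2_NtD gamma f)
  (L2_NtD (perturbed gamma0 beta betaL s C) f) Lg.
have eG := model_error_form model h0 Lgamma df Lg gf.
have eW := model_error_form model h0 Lw df Lg gf.
have eN := opnorm_form nN df LN Lg gf.
rewrite -mulrDr -mulrBr normrM normr_sgnR mul1r.
set w := perturbed _ _ _ _ _ in eW *.
move: (rip _ (NtD gamma f) g) (rip _ (NtD w f) g) (rip _ (Lambdah h gamma f) g)
  (rip _ (Lambdah h w f) g) (rip _ (N delta f) g) eG eW eN => x y x' y' z eG eW eN.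
rewrite (_ : _ - _ = (x - x') - (y - y') - z); last by ring.
apply: (le_trans (ler_normB _ _)); rewrite mulrDl lerD//.
by apply: (le_trans (ler_normB _ _)); rewrite mulrDr mulrDl lerD.
Qed.

(** Let [W] be the sum of the norms of the two conductivities. Passing the test
    with parameters for which [`|omega h|], [delta] and [alU h delta] are at most
    [e] gives, at a current [f], a real part of the form of at least
    [- e * (W + 2)] and an imaginary part of absolute value at most
    [e * (W + 2)], times the squared norm of [f]. *)
Lemma exact_test_passes s C (al alU : R -> R -> R) : closed C ->
  (forall h delta, 0 < h -> 0 < delta -> al h delta <= alU h delta) ->
  (fun p => alU p.1 p.2) @ filter_prod (0^'+) (0^'+) --> (0 : R) ->
  (forall e, 0 < e -> exists h delta, [/\ 0 < h <= e, 0 < delta <= e &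
     pos_op sigma (op_add (Thd h delta s C) (op_scal (mkK k (al h delta) 0)))]) ->
  pos_op sigma (op_add (T s C) (op_scal (mkK k 0 0))).
Proof.
move=> cC alle alU0 often.
pose W := Linf_norm gamma + Linf_norm (perturbed gamma0 beta betaL s C).
have Linf0 w : 0 <= Linf_norm w by rewrite fine_ge0 ?Lnorm_ge0.
have W0 : 0 <= W by rewrite addr_ge0.
have good e : 0 < e -> exists h delta, [/\ 0 < h, 0 < delta,
    pos_op sigma (op_add (Thd h delta s C) (op_scal (mkK k (al h delta) 0))) &
    `|omega h| <= e /\ delta <= e /\ al h delta <= e].
  move=> e0.
  have /cvgrPdist_le/(_ e e0) [e1 /= e10 He1] := model.2.
  have /cvgrPdist_le/(_ e e0) [[P Q] /= [[e2 /= e20 He2] [e3 /= e30 He3]] PQ] := alU0.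
  (* halving makes the inequalities given by the test strict *)
  pose r := Num.min (Num.min e (e1 / 2)) (Num.min (e2 / 2) (e3 / 2)).
  have r0 : 0 < r by rewrite !lt_min e0 !divr_gt0.
  have [h [delta [/andP[h0 hr] /andP[delta0 dr] pos]]] := often r r0.
  move: hr dr; rewrite !le_min => /andP[/andP[_ h1] /andP[h2 _]].
  move=> /andP[/andP[de _] /andP[_ d3]].
  have half (y : R) : 0 < y -> y / 2 < y by move=> ?; rewrite ltr_pdivrMr// ltr_pMr// ltr1n.
  have close (x y : R) : 0 < x -> 0 < y -> x <= y / 2 -> ball_ Num.norm 0 y x.
    by move=> x0 y0 xy; rewrite /= sub0r normrN gtr0_norm// (le_lt_trans xy)// half.
  exists h, delta; split=> //; split; [|split=> //].
    by have := He1 h (close _ _ h0 e10 h1) h0; rewrite sub0r normrN.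
  apply: (le_trans (alle h delta h0 delta0)).
  have /= := PQ (h, delta) (conj (He2 h (close _ _ h0 e20 h2) h0)
    (He3 delta (close _ _ delta0 e30 d3) delta0)).
  by rewrite sub0r normrN => /(le_trans (ler_norm _)).
have LT f : L2diamond sigma f -> L2 sigma (T s C f).
  move=> [Lf _].
  by have [] := rip_Top (L := @NtD R d k Omega) (L2_NtD gamma f)
    (L2_NtD (perturbed gamma0 beta betaL s C) f) Lf.
have LThd h delta : 0 < h -> 0 < delta ->
    forall f, L2diamond sigma f -> L2 sigma (Thd h delta s C f).
  by move=> h0 delta0 f df; have [Lf _] := df; have [] := noisy_form s h0 delta0 cC df Lf.
apply/(pos_op_shiftP _ LT) => f df; have [Lf _] := df; have rf := L2_rotate Lf.
have n0 := rip_ge0 sigma f.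
have K0 : 0 <= (W + 2) * rip sigma f f by rewrite mulr_ge0// addr_ge0.
rewrite mul0r addr0; split.
- rewrite -oppr_le0; apply: (le0_of_small K0) => e /good[h [delta [h0 delta0 pos [eo [ed ea]]]]].
  have /(pos_op_shiftP _ (LThd h delta h0 delta0))/(_ f df)[pf _] := pos.
  have := noisy_form_error s h0 delta0 cC df Lf (lexx _).
  have : (`|omega h| * W + delta) * rip sigma f f <= (e * W + e) * rip sigma f f.
    by rewrite ler_wpM2r// lerD// ler_wpM2r.
  have : al h delta * rip sigma f f <= e * rip sigma f f by rewrite ler_wpM2r.
  rewrite -/W => al_e err_e err; have := le_trans err err_e.
  rewrite ler_norml => /andP[low _].
  by lra.
- apply/eqP; rewrite -normr_le0; apply: (le0_of_small K0) => e.
  move=> /[dup] e0 /good[h [delta [h0 delta0 pos [eo [ed ea]]]]].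
  have /(pos_op_shiftP _ (LThd h delta h0 delta0))/(_ f df)[_ pf] := pos.
  have := noisy_form_error s h0 delta0 cC df rf (rip_rotate Lf).
  rewrite pf subr0 -/W => /le_trans; apply.
  rewrite mulrA ler_wpM2r//.
  have : `|omega h| * W <= e * W by rewrite ler_wpM2r.
  lra.
Qed.

End Comparison.

End NtDForms.

Theorem corollary3p2 (R : realType) (d : nat) (k : scalars)
    (Omega : set 'rV[R]_d)
    (gamma0 kappap kappam : 'rV[R]_d -> R) (Dp Dm : set 'rV[R]_d)
    (betaL beta : R)
    (Lambdah : R -> ('rV[R]_d -> R) ->
       oper (caratheodory_type (surface_outer Omega)) R k)
    (omega : R -> R)
    (N : R -> oper (caratheodory_type (surface_outer Omega)) R k)
    (alpha : sgn -> R -> R -> set 'rV[R]_d -> R)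
    (alphaL alphaU : sgn -> R -> R -> R) :
  let mu := volume Omega in
  let gamma := indefinite_gamma gamma0 kappap kappam Dp Dm in
  let T s C := Top gamma0 beta betaL (NtD gamma) (@NtD R d k Omega) s C in
  let Th h s C := Top gamma0 beta betaL (Lambdah h gamma) (Lambdah h) s C in
  let Thd h delta s C :=
    Top gamma0 beta betaL (op_add (Lambdah h gamma) (N delta)) (Lambdah h) s C in
  let M := Mset2 (fun=> 0) (fun=> 0) (T Plus) (T Minus) in
  let Ms s := Mset1 (fun=> 0) (T s) in
  let star (s : sgn) (F : set (set 'rV[R]_d)) :=
    (forall h delta, 0 < h -> 0 < delta ->
      ((delta - alphaL s h delta)%:E <=
       ereal_inf [set inf_spectrum (surface Omega) (Th h s C) | C in F])%E) /\
    (fun p => alphaU s p.1 p.2) @ filter_prod (0^'+) (0^'+) --> (0 : R) in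
  let Mhd h delta :=
    Mset2 (alpha Plus h delta) (alpha Minus h delta)
          (Thd h delta Plus) (Thd h delta Minus) in
  let Mshd s h delta := Mset1 (alpha s h delta) (Thd h delta s) in
  (2 <= d)%N ->
  smooth_domain Omega -> connected (~` closure Omega) ->
  indefinite_inclusion Omega gamma0 kappap kappam Dp Dm ->
  Linf_plus Omega gamma ->
  0 < betaL -> (\forall x \ae mu, betaL <= gamma0 x) ->
  0 < beta ->
  (ess_sup mu (fun x => (kappap x)%:E) <= beta%:E)%E ->
  (ess_sup mu (fun x => (kappam x)%:E) <= (beta / (1 + beta) * betaL)%:E)%E ->
  approximate_model Lambdah omega ->
  noise_model N ->
  (forall s h delta C, 0 < h -> 0 < delta -> test_inclusion Omega C ->
    alphaL s h delta <= alpha s h delta C <= alphaU s h delta) ->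
  ((forall s, star s M) ->
    set_limit Mhd M /\
    M = \bigcap_(p in [set p : R * R | 0 < p.1 /\ 0 < p.2]) Mhd p.1 p.2) /\
  ((forall s, star s (Ms s)) ->
    forall s, set_limit (Mshd s) (Ms s) /\
      Ms s = \bigcap_(p in [set p : R * R | 0 < p.1 /\ 0 < p.2]) Mshd s p.1 p.2).
Proof.
move=> mu gamma T Th Thd M Ms star Mhd Mshd _ _ _ [[Lgamma0 _ _] _ _ _] Lgamma.
move=> betaL0 gamma0_ge beta0 _ _ model noise al_bounds.
have al_leU s h delta C : test_inclusion Omega C -> 0 < h -> 0 < delta ->
    alpha s h delta C <= alphaU s h delta.
  by move=> tC h0 delta0; have /andP[] := al_bounds s h delta C h0 delta0 tC.
have noisy_of_mem s F h delta C : star s F -> F C -> test_inclusion Omega C ->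
    0 < h -> 0 < delta ->
    pos_op (surface Omega)
      (op_add (Thd h delta s C) (op_scal (mkK k (alpha s h delta C) 0))).
  move=> [spec _] FC tC h0 delta0; have [_ cC _] := tC.
  apply: (noisy_test_passes Lgamma0 Lgamma betaL0 beta0 gamma0_ge model noise) => //.
  apply: (@le_trans _ _ (delta - alphaL s h delta)%:E).
    by rewrite lee_fin lerB//; have /andP[] := al_bounds s h delta C h0 delta0 tC.
  by apply: (le_trans (spec h delta h0 delta0)); apply: ereal_inf_lbound; exists C.
have exact_of_often s F C : star s F -> test_inclusion Omega C ->
    (forall e, 0 < e -> exists h delta, [/\ 0 < h <= e, 0 < delta <= e &
      pos_op (surface Omega)
        (op_add (Thd h delta s C) (op_scal (mkK k (alpha s h delta C) 0)))]) ->
    pos_op (surface Omega) (op_add (T s C) (op_scal (mkK k 0 0))).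
  move=> [_ aU0] tC often; have [_ cC _] := tC.
  apply: (exact_test_passes Lgamma0 Lgamma betaL0 beta0 gamma0_ge model noise cC
    _ aU0 often).
  by move=> h delta; exact: al_leU.
split=> [st|st s]; apply: set_limit_squeeze.
- move=> h delta h0 delta0 C MC; have [tC _ _] := MC.
  by split=> //; exact: noisy_of_mem MC tC h0 delta0.
- move=> C often.
  have tC : test_inclusion Omega C.
    by have [h [delta [_ _ []]]] := often 1 ltr01.
  split=> //.
  + apply: exact_of_often (st Plus) tC _ => e /often[h [delta [he de [_ pos _]]]].
    by exists h, delta.
  + apply: exact_of_often (st Minus) tC _ => e /often[h [delta [he de [_ _ pos]]]].
    by exists h, delta.
- move=> h delta h0 delta0 C MC; have [tC _ _] := MC.
  by split=> //; exact: noisy_of_mem (st s) MC tC h0 delta0.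
- move=> C often.
  have tC : test_inclusion Omega C.
    by have [h [delta [_ _ []]]] := often 1 ltr01.
  have pos : pos_op (surface Omega) (op_add (T s C) (op_scal (mkK k 0 0))).
    apply: exact_of_often (st s) tC _ => e /often[h [delta [he de [_ pos _]]]].
    by exists h, delta.
  by split.
Qed.
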